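(* For every $b>0$ there exists $\sigma(b)\in\mathbb R$ such that the solution $y_b(x)$ is analytic on the interval $(-\infty,\sigma(b))$ and has a simple pole at $\sigma(b)$ with residue $-1$. Moreover: 1. The map $b\mapsto\sigma(b)$ is a strictly decreasing bijection from $(0,\infty)$ to $\mathbb R$. 2. If $b>b'\ge 0$, then $y_b(x)>y_{b'}(x)$ for all $x\in(-\infty,\sigma(b))$.
   Context: The Painlevé II equation is $y''(x)=x\,y(x)+2y(x)^3$. The Hastings–McLeod solution $y_0$ is the real solution, real analytic on all of $\mathbb R$, with $y_0(x)=\sqrt{-x/2}\,(1+o(1))$ as $x\to-\infty$ and $y_0(x)=\mathrm{Ai}(x)(1+o(1))$ as $x\to+\infty$, where $\mathrm{Ai}$ is the Airy function. For $b\in\mathbb R$, $y_b$ denotes the (real, meromorphic) solution of the Painlevé II equation characterized by $$y_b(x)=y_0(x)+\frac{b}{(-x)^{1/4}}\exp\left(-\frac{2\sqrt2}{3}(-x)^{3/2}\right)(1+o(1)),\qquad x\to-\infty$$ (for $b=0$ it is the Hastings–McLeod solution). It is a known fact that such a solution exists and is unique for each $b\in\mathbb R$, and these are exactly the real solutions with $y(x)=\sqrt{-x/2}\,(1+o(1))$ as $x\to-\infty$. *)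

(* Defs.v *)
(* Vanilla Stdlib reals and Coquelicot. *)
From Stdlib Require Export Reals.
From Coquelicot Require Export Coquelicot.

Open Scope R_scope.

Definition analytic_at (f : C -> C) (z : C) : Prop :=
  exists (a : nat -> C) (r : R), 0 < r /\
    forall w : C, Cmod (w - z)%C < r -> is_pseries a (w - z)%C (f w).

(* On a punctured disc around z, f w = \sum_k a k * (w - z)^(k - m).
   The value of f at z itself is irrelevant. *)
Definition laurent_at (f : C -> C) (z : C) (m : nat) (a : nat -> C) : Prop :=
  exists r : R, 0 < r /\
    forall w : C, w <> z -> Cmod (w - z)%C < r ->
      is_pseries a (w - z)%C ((w - z) ^ m * f w)%C.

Definition pole_of_order (f : C -> C) (z : C) (m : nat) : Prop :=
  (0 < m)%nat /\ exists a : nat -> C, a 0%nat <> RtoC 0 /\ laurent_at f z m a.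

Definition simple_pole (f : C -> C) (z : C) : Prop := pole_of_order f z 1.

(* c is the coefficient of (w - z)^(-1). *)
Definition has_residue (f : C -> C) (z c : C) : Prop :=
  exists (m : nat) (a : nat -> C), laurent_at f z (S m) a /\ a m = c.

(* Meromorphic on the whole plane. A pole is a point of the domain at which
   the value of f is arbitrary. *)
Definition meromorphic (f : C -> C) : Prop :=
  forall z : C, analytic_at f z \/ exists m : nat, pole_of_order f z m.

(* C_derive f z is the derivative of f only where f is differentiable, which is
   why differentiability of f is required separately. *)
Definition painleve2_solution (f : C -> C) : Prop :=
  meromorphic f /\
  forall z : C, analytic_at f z ->
    ex_derive f z /\
    is_derive (C_derive f) z (z * f z + 2 * f z ^ 3)%C.

Definition real_on_axis (f : C -> C) : Prop :=
  forall x : R, analytic_at f (RtoC x) -> Im (f (RtoC x)) = 0.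

(* To be used at real points that are not poles of a real function. *)
Definition on_axis (f : C -> C) (x : R) : R := Re (f (RtoC x)).

Definition airy_Ai (x : R) : R :=
  / PI * RInt_gen (fun t : R => cos (t ^ 3 / 3 + x * t))
           (at_point 0) (Rbar_locally p_infty).

(* is_equiv F g h, that is |h - g| <= eps * |h| eventually along F for every
   eps > 0, expresses g = h * (1 + o(1)). *)
Definition hastings_mcleod (f : C -> C) : Prop :=
  painleve2_solution f /\
  real_on_axis f /\
  (forall x : R, analytic_at f (RtoC x)) /\
  is_equiv (Rbar_locally m_infty) (on_axis f) (fun x : R => sqrt (- x / 2)) /\
  is_equiv (Rbar_locally p_infty) (on_axis f) airy_Ai.

(* For b = 0 the asymptotic condition says that f and f0 agree at all
   sufficiently negative x. *)
Definition hm_perturbation (f0 : C -> C) (b : R) (f : C -> C) : Prop :=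
  painleve2_solution f /\
  real_on_axis f /\
  is_equiv (Rbar_locally m_infty)
    (fun x : R => on_axis f x - on_axis f0 x)
    (fun x : R => b / Rpower (- x) (1 / 4)
                  * exp (- (2 * sqrt 2 / 3) * Rpower (- x) (3 / 2))).

(* Main.v *)
Require Import Defs.
From Stdlib Require Import Lra Lia Psatz Classical IndefiniteDescription.

(** Everything is proved on the real axis, for real solutions of
    u'' = x u + 2 u^3; the complex plane enters only through the dichotomy
    between analytic points and poles.

    A priori bound ([keller_osserman]). A barrier that blows up at both ends of
    an interval shows that a solution existing on [c - L, c + L] satisfies
    u(c) <= 3/L + k once k^2 bounds -x there. So large values force a pole
    nearby, and a solution without poles decays at +infinity.

    The Hastings-McLeod solution q. The behaviour at -infinity and the absence
    of poles determine what is needed ([separating]). With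
    D = -(q^2 + x/2), the energy G = q'^2 - D^2 satisfies G' = D, and a critical
    point of q with D >= 0 would trap q in D > 0 all the way to -infinity, where
    q'' = -2 q D would then make q concave and send it to -infinity
    ([no_trapped_critical_point]). Since q tends to 0 at +infinity, a zero of q
    would create such a critical point; hence q > 0. The Riccati equation for
    q'/q then gives q' < 0.

    Comparison. The function p = -q' > 0 satisfies
    p'' = (x + 6 q^2) p - q, while the difference w = u - v of two solutions
    satisfies w'' = V w with V = x + 2 (u^2 + u v + v^2), and V >= x + 6 q^2 as
    long as u >= v >= q. So the Wronskian w' p - w p' increases, it is positive
    ([wronskian_positive]), and w/p increases. Therefore an order that holds
    near -infinity persists ([comparison]), which is the strict monotonicity
    in b. It also follows that no second solution above q lives on the whole
    line ([no_other_global_solution]): for b > 0 there is a first singularity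
    sigma(b), a pole. Substituting the Laurent expansion into the equation
    gives a simple pole with residue 1 or -1 and vanishing constant term
    ([laurent_pole_order_one]), and y_b > 0 selects -1.

    The map sigma. If two members of the family had the same first pole, their
    difference would tend to 0 there because the constant terms vanish,
    although w/p increases; so sigma is strictly decreasing
    ([sigma_decreasing]). Comparing the differences of three members by their
    Wronskian shows that b |-> y_b(x) is convex ([convex_in_parameter]), which
    replaces continuous dependence on the data at -infinity. Convexity gives
    continuity in b where a larger parameter is available, and a growth
    estimate for the equation supplies that larger parameter
    ([regular_right_neighbour]). Together with the a priori bound this makes
    sigma surjective ([sigma_surjective]). *)

(** * Calculus on an interval *)

Lemma mean_value (f df : R -> R) (a b : R) :
  a < b -> (forall c, a <= c <= b -> is_derive f c (df c)) ->
  exists c, a < c < b /\ f b - f a = df c * (b - a).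
Proof.
intros hab hf.
destruct (MVT_cor2 f df a b hab) as [c [h1 h2]].
  intros c hc; apply is_derive_Reals; auto.
exists c; auto.
Qed.

Lemma nondecreasing_of_derive (f df : R -> R) (a b : R) :
  a <= b -> (forall c, a <= c <= b -> is_derive f c (df c)) ->
  (forall c, a < c < b -> 0 <= df c) -> f a <= f b.
Proof.
intros hab hf h0.
destruct hab as [hab | ->]; [| lra].
destruct (mean_value f df a b hab hf) as [c [hc e]].
specialize (h0 c hc); nra.
Qed.

Lemma increasing_of_derive (f df : R -> R) (a b : R) :
  a < b -> (forall c, a <= c <= b -> is_derive f c (df c)) ->
  (forall c, a < c < b -> 0 < df c) -> f a < f b.
Proof.
intros hab hf h0.
destruct (mean_value f df a b hab hf) as [c [hc e]].
specialize (h0 c hc); nra.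
Qed.

Lemma is_derive_continuity_pt (f : R -> R) (x l : R) :
  is_derive f x l -> continuity_pt f x.
Proof.
intros h; apply continuity_pt_filterlim.
apply (ex_derive_continuous (V := R_NormedModule)).
exists l; exact h.
Qed.

Lemma continuity_pt_near (f : R -> R) (x eps : R) :
  continuity_pt f x -> 0 < eps ->
  exists d, 0 < d /\ forall y, Rabs (y - x) < d -> Rabs (f y - f x) < eps.
Proof.
intros hf he.
destruct (proj1 (continuity_pt_locally f x) hf (mkposreal _ he)) as [d hd].
exists d; split; [apply cond_pos | exact hd].
Qed.

(** If the second derivative were positive, the first derivative would be
    positive just to the right of the maximum. *)
Lemma interior_max (f df : R -> R) (x d2 a b : R) :
  a < x < b -> (forall y, a < y < b -> is_derive f y (df y)) ->
  is_derive df x d2 -> (forall y, a < y < b -> f y <= f x) ->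
  df x = 0 /\ d2 <= 0.
Proof.
intros hx hf hdf hmax.
assert (h0 : df x = 0).
  assert (pr : derivable_pt f x).
    exists (df x); apply is_derive_Reals; auto.
  rewrite <- (deriv_maximum f a b x pr (proj1 hx) (proj2 hx)).
    symmetry; apply derive_pt_eq_0, is_derive_Reals; auto.
  intros y h1 h2; auto.
split; [exact h0 |].
apply Rnot_lt_le; intros hd2.
apply is_derive_Reals in hdf.
destruct (hdf d2 hd2) as [d hd].
pose proof (cond_pos d) as hd0.
set (y := Rmin (x + d / 2) ((x + b) / 2)).
assert (hy : x < y < b /\ y - x < d).
  unfold y, Rmin; destruct Rle_dec; lra.
assert (f x < f y); [| specialize (hmax y); lra].
apply (increasing_of_derive f df); [lra | |].
  intros c hc; apply hf; lra.
intros c hc.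
specialize (hd (c - x)).
replace (x + (c - x)) with c in hd by ring.
rewrite h0 in hd.
assert (hq : Rabs ((df c - 0) / (c - x) - d2) < d2).
  apply hd; [lra | rewrite Rabs_pos_eq; lra].
apply Rabs_def2 in hq.
replace (df c) with ((df c - 0) / (c - x) * (c - x)) by (field; lra).
apply Rmult_lt_0_compat; lra.
Qed.

Lemma first_zero (f : R -> R) (a b : R) :
  a <= b -> (forall x, a <= x <= b -> continuity_pt f x) ->
  0 < f a -> f b <= 0 ->
  exists c, a < c <= b /\ f c = 0 /\ forall x, a <= x < c -> 0 < f x.
Proof.
intros hab hf ha hb.
destruct (completeness (fun x => a <= x <= b /\ forall y, a <= y <= x -> 0 < f y))
  as [c [hub hlub]].
    exists b; intros x hx; lra.
  exists a; split; [lra |]; intros y hy; replace y with a by lra; exact ha.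
assert (hac : a <= c).
  apply hub; split; [lra |]; intros y hy; replace y with a by lra; exact ha.
assert (hcb : c <= b) by (apply hlub; intros x hx; lra).
assert (hpos : forall x, a <= x < c -> 0 < f x).
  intros x hx; apply NNPP; intros hn.
  assert (c <= x); [| lra].
  apply hlub; intros z [hz1 hz2].
  apply Rnot_lt_le; intros hxz; apply hn, hz2; lra.
destruct (Rtotal_order (f c) 0) as [h | [h | h]].
- destruct (continuity_pt_near f c (- f c)) as [d [hd0 hd]];
    [apply hf; lra | lra |].
  assert (hne : a < c) by (destruct hac as [? | <-]; [assumption | lra]).
  set (y := Rmax a (c - d / 2)).
  assert (hy : a <= y < c /\ c - d < y).
    unfold y, Rmax; destruct Rle_dec; lra.
  specialize (hpos y (proj1 hy)).
  specialize (hd y); rewrite Rabs_left in hd by lra.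
  assert (hd' : Rabs (f y - f c) < - f c) by (apply hd; lra).
  apply Rabs_def2 in hd'; lra.
- exists c; split; [| auto].
  split; [| exact hcb].
  destruct hac as [? | e]; [assumption | rewrite <- e in h; lra].
- destruct (continuity_pt_near f c (f c)) as [d [hd0 hd]];
    [apply hf; lra | lra |].
  assert (hne : c < b) by (destruct hcb as [? | e]; [assumption | rewrite e in h; lra]).
  set (y := Rmin b (c + d / 2)).
  assert (hy : c < y <= b /\ y < c + d).
    unfold y, Rmin; destruct Rle_dec; lra.
  assert (y <= c); [| lra].
  apply hub; split; [lra |].
  intros z hz; destruct (Rlt_le_dec z c) as [hzc | hzc]; [apply hpos; lra |].
  specialize (hd z); rewrite Rabs_pos_eq in hd by lra.
  assert (hd' : Rabs (f z - f c) < f c) by (apply hd; lra).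
  apply Rabs_def2 in hd'; lra.
Qed.

Lemma last_zero (f : R -> R) (a b : R) :
  a <= b -> (forall x, a <= x <= b -> continuity_pt f x) ->
  f a <= 0 -> 0 < f b ->
  exists c, a <= c < b /\ f c = 0 /\ forall x, c < x <= b -> 0 < f x.
Proof.
intros hab hf ha hb.
destruct (first_zero (fun x => f (- x)) (- b) (- a)) as [c [hc [h0 h1]]].
- lra.
- intros x hx.
  apply (continuity_pt_comp Ropp f).
    apply continuity_pt_opp, continuity_pt_id.
  apply hf; lra.
- rewrite Ropp_involutive; exact hb.
- rewrite Ropp_involutive; exact ha.
- exists (- c); split; [lra | split; [exact h0 |]].
  intros x hx; rewrite <- (Ropp_involutive x); apply h1; lra.
Qed.

(** Integrating the bound on the second derivative twice, which is done here by
    two monotonicity arguments. *)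
Lemma taylor_upper_right (f df ddf : R -> R) (a b m : R) :
  a <= b ->
  (forall x, a <= x <= b -> is_derive f x (df x)) ->
  (forall x, a <= x <= b -> is_derive df x (ddf x)) ->
  (forall x, a <= x <= b -> ddf x <= m) ->
  f b <= f a + df a * (b - a) + m * (b - a) ^ 2 / 2.
Proof.
intros hab h1 h2 h3.
assert (hd : forall x, a <= x <= b -> df x <= df a + m * (x - a)).
  intros x hx.
  assert (m * a - df a <= m * x - df x); [| lra].
  apply (nondecreasing_of_derive (fun t => m * t - df t) (fun t => m - ddf t)); [lra | |].
    intros c hc; assert (hc' : a <= c <= b) by lra; specialize (h2 c hc').
    auto_derive; [exists (ddf c); exact h2 | rewrite (is_derive_unique (fun t : R => df t) c _ h2); ring].
  intros c hc; assert (hc' : a <= c <= b) by lra; specialize (h3 c hc'); lra.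
assert (df a * a + m * (a - a) ^ 2 / 2 - f a <= df a * b + m * (b - a) ^ 2 / 2 - f b); [| lra].
apply (nondecreasing_of_derive (fun t => df a * t + m * (t - a) ^ 2 / 2 - f t)
  (fun t => df a + m * (t - a) - df t)); [lra | |].
  intros c hc; specialize (h1 c hc).
  auto_derive; [exists (df c); exact h1 | rewrite (is_derive_unique (fun t : R => f t) c _ h1); field].
intros c hc; assert (hc' : a <= c <= b) by lra; specialize (hd c hc'); lra.
Qed.

Lemma is_derive_reflect (f : R -> R) (x l : R) :
  is_derive f (- x) l -> is_derive (fun t => f (- t)) x (- l).
Proof.
intros h; auto_derive; [exists l; exact h |].
rewrite (is_derive_unique (fun t : R => f t) (- x) l h); ring.
Qed.

Lemma taylor_upper_left (f df ddf : R -> R) (a b m : R) :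
  a <= b ->
  (forall x, a <= x <= b -> is_derive f x (df x)) ->
  (forall x, a <= x <= b -> is_derive df x (ddf x)) ->
  (forall x, a <= x <= b -> ddf x <= m) ->
  f a <= f b - df b * (b - a) + m * (b - a) ^ 2 / 2.
Proof.
intros hab h1 h2 h3.
pose proof (taylor_upper_right (fun t => f (- t)) (fun t => - df (- t)) (fun t => ddf (- t))
  (- b) (- a) m) as h.
cbv beta in h; rewrite !Ropp_involutive in h.
replace (- a - - b) with (b - a) in h by ring.
replace (f b - df b * (b - a)) with (f b + - df b * (b - a)) by ring.
apply h.
- lra.
- intros x hx; apply is_derive_reflect, h1; lra.
- intros x hx.
  replace (ddf (- x)) with (- - ddf (- x)) by ring.
  apply (is_derive_opp (fun t => df (- t))), is_derive_reflect, h2; lra.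
- intros x hx; apply h3; lra.
Qed.

Lemma taylor_lower_right (f df ddf : R -> R) (a b m : R) :
  a <= b ->
  (forall x, a <= x <= b -> is_derive f x (df x)) ->
  (forall x, a <= x <= b -> is_derive df x (ddf x)) ->
  (forall x, a <= x <= b -> m <= ddf x) ->
  f a + df a * (b - a) + m * (b - a) ^ 2 / 2 <= f b.
Proof.
intros hab h1 h2 h3.
pose proof (taylor_upper_right (fun t => - f t) (fun t => - df t) (fun t => - ddf t)
  a b (- m) hab) as h.
assert (- f b <= - f a + - df a * (b - a) + - m * (b - a) ^ 2 / 2); [| lra].
apply h; intros x hx.
- apply (is_derive_opp f), h1, hx.
- apply (is_derive_opp df), h2, hx.
- specialize (h3 x hx); lra.
Qed.

Lemma positive_left_of_zero (f : R -> R) (x l : R) :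
  f x = 0 -> is_derive f x l -> l < 0 ->
  exists d, 0 < d /\ forall y, x - d < y < x -> 0 < f y.
Proof.
intros h0 hf hl.
apply is_derive_Reals in hf.
destruct (hf (- l) ltac:(lra)) as [d hd].
exists d; split; [apply cond_pos |].
intros y hy.
specialize (hd (y - x) ltac:(lra)).
replace (x + (y - x)) with y in hd by ring.
rewrite h0 in hd.
assert (hq : Rabs ((f y - 0) / (y - x) - l) < - l).
  apply hd; rewrite Rabs_left; lra.
apply Rabs_def2 in hq.
replace (f y) with (((f y - 0) / (y - x)) * (y - x)) by (field; lra).
nra.
Qed.

Lemma eq_at_puncture (p q : R -> R) (r : R) :
  0 < r -> continuity_pt p 0 -> continuity_pt q 0 ->
  (forall t, 0 < t < r -> p t = q t) -> p 0 = q 0.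
Proof.
intros hr hp hq h.
apply NNPP; intros hne.
set (e := Rabs (p 0 - q 0) / 2).
assert (he : 0 < e) by (assert (0 < Rabs (p 0 - q 0)) by (apply Rabs_pos_lt; lra); unfold e; lra).
destruct (continuity_pt_near p 0 e hp he) as [d1 [hd10 hd1]].
destruct (continuity_pt_near q 0 e hq he) as [d2 [hd20 hd2]].
set (t := Rmin (Rmin d1 d2) r / 2).
assert (ht : 0 < t < r /\ t < d1 /\ t < d2).
  assert (0 < Rmin (Rmin d1 d2) r) by (repeat apply Rmin_glb_lt; lra).
  unfold t; pose proof (Rmin_l (Rmin d1 d2) r); pose proof (Rmin_r (Rmin d1 d2) r);
  pose proof (Rmin_l d1 d2); pose proof (Rmin_r d1 d2); lra.
specialize (hd1 t); specialize (hd2 t).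
rewrite Rminus_0_r, Rabs_pos_eq in hd1, hd2 by lra.
specialize (hd1 ltac:(lra)); specialize (hd2 ltac:(lra)).
rewrite (h t ltac:(lra)) in hd1.
pose proof (Rabs_triang (p 0 - q t) (q t - q 0)) as h1.
replace (p 0 - q t + (q t - q 0)) with (p 0 - q 0) in h1 by ring.
rewrite (Rabs_minus_sym (p 0) (q t)) in h1.
unfold e in *; lra.
Qed.

Lemma continuity_pt_pow (p : R -> R) (k : nat) (x : R) :
  continuity_pt p x -> continuity_pt (fun t => p t ^ k) x.
Proof.
intros hp; induction k as [| k IH].
  apply continuity_pt_const; intros y1 y2; reflexivity.
apply (continuity_pt_mult p (fun t => p t ^ k)); assumption.
Qed.

Ltac polynomial_continuity :=
  repeat match goal with
  | |- continuity_pt (fun t => t) _ => apply continuity_pt_id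
  | |- continuity_pt (fun _ => ?k) _ => apply continuity_pt_const; intros ? ?; reflexivity
  | H : continuity_pt ?p ?x |- continuity_pt (fun t => ?p t) ?x => exact H
  | |- continuity_pt (fun t => @?p t + @?q t) _ => apply (continuity_pt_plus p q)
  | |- continuity_pt (fun t => @?p t - @?q t) _ => apply (continuity_pt_minus p q)
  | |- continuity_pt (fun t => @?p t * @?q t) _ => apply (continuity_pt_mult p q)
  | |- continuity_pt (fun t => @?p t ^ ?k) _ => apply (continuity_pt_pow p k)
  end.

(** * Real solutions and the a priori bound *)

Definition solves_at (u : R -> R) (x : R) : Prop :=
  ex_derive u x /\ is_derive (Derive u) x (x * u x + 2 * u x ^ 3).

Lemma solves_is_derive (u : R -> R) (x : R) :
  solves_at u x -> is_derive u x (Derive u x).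
Proof. intros [h _]; apply Derive_correct, h. Qed.

Lemma solves_ex_derive2 (u : R -> R) (x : R) :
  solves_at u x -> ex_derive (Derive u) x.
Proof. intros [_ h]; eexists; exact h. Qed.

Lemma solves_Derive2 (u : R -> R) (x : R) :
  solves_at u x -> Derive (fun t => Derive u t) x = x * u x + 2 * u x ^ 3.
Proof. intros [_ h]; apply is_derive_unique, h. Qed.

Lemma solves_continuity (u : R -> R) (x : R) :
  solves_at u x -> continuity_pt u x.
Proof. intros h; eapply is_derive_continuity_pt, solves_is_derive, h. Qed.

(** Second derivatives of solutions are eliminated by the equation; the first ones are
    abstracted because ring does not identify them up to eta-expansion. *)
Ltac derive_solutions :=
  auto_derive;
  [ repeat match goal with
    | |- _ /\ _ => split
    | |- True => exact I
    | H : solves_at ?u ?x |- ex_derive (fun t => Derive ?u t) ?x =>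
      exact (solves_ex_derive2 u x H)
    | H : solves_at ?u ?x |- ex_derive (fun t => ?u t) ?x => exact (proj1 H)
    end
  | repeat match goal with
    | H : solves_at ?u ?x |- context [Derive (fun t => Derive ?u t) ?x] =>
      rewrite (solves_Derive2 u x H)
    end;
    repeat match goal with
    | |- context [Derive ?f ?x] => let d := fresh "d" in set (d := Derive f x)
    end ].

(** The function 3 L / (L^2 - (x - c)^2) + k is a supersolution that is infinite at both
    ends. Multiplying u - k by B = L^2 - (x - c)^2 turns the comparison with it
    into the interior maximum of a function continuous on the closed interval:
    where (u - k) B exceeds 3 L, the cubic term makes its second derivative
    positive at a critical point. *)
Lemma keller_osserman (u : R -> R) (c L k : R) :
  0 < L -> 0 <= k -> L - c <= k ^ 2 ->
  (forall x, c - L <= x <= c + L -> solves_at u x) ->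
  u c <= 3 / L + k.
Proof.
intros hL hk hkc hu.
set (psi := fun x => (u x - k) * (L ^ 2 - (x - c) ^ 2)).
set (dpsi := fun x => Derive u x * (L ^ 2 - (x - c) ^ 2) - (u x - k) * (2 * (x - c))).
assert (hd : forall x, c - L <= x <= c + L -> is_derive psi x (dpsi x)).
  intros x hx; unfold psi, dpsi; specialize (hu x hx).
  derive_solutions.
  ring.
destruct (continuity_ab_maj psi (c - L) (c + L)) as [m [hm hmI]]; [lra | |].
  intros x hx; eapply is_derive_continuity_pt, hd, hx.
assert (hc : psi c <= psi m) by (apply hm; lra).
apply Rnot_lt_le; intros hbig.
assert (hpc : 3 * L < psi c).
  unfold psi.
  replace ((u c - k) * (L ^ 2 - (c - c) ^ 2)) with ((u c - k) * L * L) by ring.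
  apply Rmult_lt_compat_r; [exact hL |].
  apply (Rmult_lt_reg_r (/ L)); [apply Rinv_0_lt_compat, hL |].
  replace ((u c - k) * L * / L) with (u c - k) by (field; lra).
  unfold Rdiv in hbig; lra.
assert (hmI' : c - L < m < c + L).
  assert (e : psi m = (u m - k) * ((L - (m - c)) * (L + (m - c)))) by (unfold psi; ring).
  split; apply Rnot_le_lt; intros h.
    replace (L + (m - c)) with 0 in e by lra; lra.
  replace (L - (m - c)) with 0 in e by lra; lra.
destruct (interior_max psi dpsi m
  ((m * u m + 2 * u m ^ 3) * (L ^ 2 - (m - c) ^ 2) - 4 * (m - c) * Derive u m - 2 * (u m - k))
  (c - L) (c + L)) as [h1 h2].
- exact hmI'.
- intros y hy; apply hd; lra.
- specialize (hu m hmI). unfold dpsi.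
  derive_solutions.
  ring.
- intros y hy; apply hm; lra.
- revert h1 h2; unfold dpsi.
  assert (hB : 0 < L ^ 2 - (m - c) ^ 2) by nra.
  assert (hxi : (m - c) ^ 2 < L ^ 2) by lra.
  assert (hpm : 3 * L < (u m - k) * (L ^ 2 - (m - c) ^ 2)) by (unfold psi in *; lra).
  assert (hx : - m <= k ^ 2) by lra.
  revert hB hxi hpm; set (B := L ^ 2 - (m - c) ^ 2).
  assert (hBe : (m - c) ^ 2 = L ^ 2 - B) by (unfold B; ring).
  revert hBe.
  generalize (m - c); intros xi hBe hB hxi hpm h1 h2.
  set (U := u m - k) in *.
  assert (hU : 0 < U) by (apply Rnot_le_lt; intros hU; nra).
  assert (hum : u m = U + k) by (unfold U; ring).
  assert (hcub : U ^ 3 <= m * u m + 2 * u m ^ 3).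
    rewrite hum.
    assert (0 <= (m + k ^ 2) * (U + k)) by (apply Rmult_le_pos; lra).
    assert (0 <= U * k) by nra. assert (0 <= U ^ 2 * k) by nra.
    assert (0 <= U * k ^ 2) by nra. assert (0 <= k ^ 3) by (apply pow_le; lra).
    assert (0 <= U ^ 3) by (apply pow_le; lra).
    nra.
  assert (hD : Derive u m * B = 2 * U * xi) by lra.
  assert (h3 : ((m * u m + 2 * u m ^ 3) * B - 4 * xi * Derive u m - 2 * U) * B <= 0) by nra.
  replace (((m * u m + 2 * u m ^ 3) * B - 4 * xi * Derive u m - 2 * U) * B)
    with ((m * u m + 2 * u m ^ 3) * B ^ 2 - 4 * xi * (Derive u m * B) - 2 * U * B) in h3 by ring.
  rewrite hD in h3.
  assert (h4 : U ^ 3 * B ^ 2 <= (m * u m + 2 * u m ^ 3) * B ^ 2).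
    apply Rmult_le_compat_r; [apply pow2_ge_0 | exact hcub].
  assert (h5 : 9 * L ^ 2 < (U * B) ^ 2) by nra.
  assert (h6 : U * (9 * L ^ 2) < U ^ 3 * B ^ 2).
    replace (U ^ 3 * B ^ 2) with (U * (U * B) ^ 2) by ring.
    apply Rmult_lt_compat_l; lra.
  assert (h7 : 0 < U * (9 * L ^ 2 - 8 * xi ^ 2 - 2 * B)).
    apply Rmult_lt_0_compat; [lra |]; nra.
  nra.
Qed.

Lemma solves_at_opp (u : R -> R) (x : R) :
  solves_at u x -> solves_at (fun t => - u t) x.
Proof.
intros [h1 h2]; split.
  apply (ex_derive_opp u), h1.
replace (x * - u x + 2 * (- u x) ^ 3) with (- (x * u x + 2 * u x ^ 3)) by ring.
apply (is_derive_ext (fun t => - Derive u t)).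
  intros t; symmetry; apply Derive_opp.
apply (is_derive_opp (Derive u)), h2.
Qed.

(** The a priori bound for u and -u on [0, 2 c], where k = 0 is allowed. *)
Lemma decay_at_right (u : R -> R) (c : R) :
  (forall x, 0 <= x -> solves_at u x) -> 0 < c -> Rabs (u c) <= 3 / c.
Proof.
intros hu hc.
assert (h : forall v, (forall x, 0 <= x -> solves_at v x) -> v c <= 3 / c).
  intros v hv.
  pose proof (keller_osserman v c c 0) as h.
  rewrite Rplus_0_r in h; apply h; try lra.
  intros x hx; apply hv; lra.
apply Rabs_le; split.
  assert (- u c <= 3 / c); [| lra].
  apply (h (fun t => - u t)); intros x hx; apply solves_at_opp, hu, hx.
apply h, hu.
Qed.

(** * The separating solution *)

Definition infinite_at_left (q : R -> R) : Prop :=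
  forall M, exists X, forall x, x < X -> M < q x.

(** With D = -(q^2 + x/2) and G = q'^2 - D^2 one has G' = D. At the critical
    point G <= 0 <= D, so immediately to its left G < 0 < D. While D > 0, G keeps decreasing
    leftwards, and D = 0 would force G >= 0; so D stays above a positive
    constant. Then q'' = -2 q D <= -1 far to the left, and the concave function q
    cannot tend to +infinity. *)
Lemma no_trapped_critical_point (q : R -> R) (x0 : R) :
  (forall x, solves_at q x) -> infinite_at_left q ->
  Derive q x0 = 0 -> q x0 ^ 2 <= - x0 / 2 -> False.
Proof.
intros hq hinf hcrit hwell.
set (D := fun x => - (q x ^ 2 + x / 2)).
set (G := fun x => Derive q x ^ 2 - D x ^ 2).
assert (hD : forall x, is_derive D x (- (2 * q x * Derive q x + / 2))).
  intros x; specialize (hq x); unfold D; derive_solutions; field.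
assert (hG : forall x, is_derive G x (D x)).
  intros x; specialize (hq x); unfold G, D; derive_solutions; field.
assert (hDc : forall x, continuity_pt D x).
  intros x; eapply is_derive_continuity_pt, hD.
assert (hstart : exists x2, 0 < D x2 /\ G x2 < 0).
  assert (hD0 : 0 <= D x0) by (unfold D; lra).
  destruct hD0 as [hD0 | hD0].
    exists x0; split; [exact hD0 |].
    unfold G; rewrite hcrit; nra.
  destruct (positive_left_of_zero D x0 _ (eq_sym hD0) (hD x0)) as [d [hd0 hd]].
    rewrite hcrit; lra.
  exists (x0 - d / 2); split; [apply hd; lra |].
  assert (hG0 : G x0 = 0) by (unfold G; rewrite hcrit, <- hD0; ring).
  rewrite <- hG0.
  apply (increasing_of_derive G D); [lra | auto |].
  intros c hc; apply hd; lra.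
destruct hstart as [x2 [hD2 hG2]].
assert (hDpos : forall x, x <= x2 -> 0 < D x).
  intros x hx; apply Rnot_le_lt; intros hn.
  destruct (last_zero D x x2 hx (fun t _ => hDc t) hn hD2) as [c [hc [hc0 hc1]]].
  assert (G c <= G x2).
    apply (nondecreasing_of_derive G D); [lra | auto |].
    intros t ht; apply Rlt_le, hc1; lra.
  assert (0 <= G c); [| lra].
  unfold G; rewrite hc0.
  pose proof (pow2_ge_0 (Derive q c)); lra.
set (d := sqrt (- G x2)).
assert (hd : 0 < d) by (apply sqrt_lt_R0; lra).
assert (hdD : forall x, x <= x2 -> d <= D x).
  intros x hx.
  assert (hGx : G x <= G x2).
    apply (nondecreasing_of_derive G D); [lra | auto |].
    intros t ht; apply Rlt_le, hDpos; lra.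
  assert (hd2 : d ^ 2 = - G x2) by (unfold d; apply pow2_sqrt; lra).
  specialize (hDpos x hx).
  assert (d ^ 2 <= D x ^ 2).
    rewrite hd2.
    assert (G x = Derive q x ^ 2 - D x ^ 2) by reflexivity.
    pose proof (pow2_ge_0 (Derive q x)); lra.
  nra.
destruct (hinf (/ (2 * d))) as [X hX].
set (a := Rmin X x2 - 1).
assert (ha : a < X /\ a < x2).
  unfold a; pose proof (Rmin_l X x2); pose proof (Rmin_r X x2); lra.
assert (hqq : forall x, x <= a -> 0 < q x /\ x * q x + 2 * q x ^ 3 <= -1).
  intros x hx.
  assert (h1 : / (2 * d) < q x) by (apply hX; lra).
  assert (h2 : 0 < / (2 * d)) by (apply Rinv_0_lt_compat; lra).
  split; [lra |].
  assert (h3 : d <= D x) by (apply hdD; lra).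
  replace (x * q x + 2 * q x ^ 3) with (- (2 * q x * D x)) by (unfold D; field).
  assert (/ (2 * d) * (2 * d) = 1) by (field; lra).
  nra.
(* At a - T the term -T^2/2 outweighs the value and the slope at a. *)
set (T := 2 * Rabs (Derive q a) + Rabs (q a) + 2).
assert (hT : q (a - T) <= q a - Derive q a * (a - (a - T)) + -1 * (a - (a - T)) ^ 2 / 2).
  pose proof (Rabs_pos (Derive q a)); pose proof (Rabs_pos (q a)).
  apply (taylor_upper_left q (Derive q) (fun x => x * q x + 2 * q x ^ 3)).
  - unfold T; lra.
  - intros x _; apply solves_is_derive, hq.
  - intros x _; apply hq.
  - intros x hx; apply hqq; lra.
replace (a - (a - T)) with T in hT by ring.
destruct (hqq (a - T)) as [hp _].
  pose proof (Rabs_pos (Derive q a)); pose proof (Rabs_pos (q a)); unfold T; lra.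
pose proof (Rle_abs (q a)); pose proof (Rle_abs (- Derive q a)) as h1.
rewrite Rabs_Ropp in h1.
pose proof (Rabs_pos (Derive q a)); pose proof (Rabs_pos (q a)).
assert (hTe : T = 2 * Rabs (Derive q a) + Rabs (q a) + 2) by reflexivity.
clearbody T.
assert (0 <= T * (Rabs (Derive q a) + Derive q a)) by (apply Rmult_le_pos; lra).
assert (0 <= (T - 2) * Rabs (q a)) by (apply Rmult_le_pos; lra).
assert (T ^ 2 = T * (2 * Rabs (Derive q a)) + T * Rabs (q a) + 2 * T) by (rewrite hTe; ring).
lra.
Qed.

(** Gronwall's inequality for q^2 + q'^2: its product with exp (K x) is
    nondecreasing and vanishes at z. *)
Lemma vanishing_data (q : R -> R) (a z K : R) :
  a <= z -> (forall x, a <= x <= z -> solves_at q x) ->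
  (forall x, a <= x <= z -> Rabs (1 + x + 2 * q x ^ 2) <= K) ->
  q z = 0 -> Derive q z = 0 -> q a = 0.
Proof.
intros haz hq hK h0 h1.
set (N := fun x => (q x ^ 2 + Derive q x ^ 2) * exp (K * x)).
assert (hN : N a <= N z).
  apply (nondecreasing_of_derive N (fun x =>
    (2 * q x * Derive q x * (1 + x + 2 * q x ^ 2) + K * (q x ^ 2 + Derive q x ^ 2))
    * exp (K * x))); [exact haz | |].
    intros x hx; specialize (hq x hx); unfold N; derive_solutions; ring.
  intros x hx.
  apply Rmult_le_pos; [| apply Rlt_le, exp_pos].
  assert (hx' : a <= x <= z) by lra.
  specialize (hK x hx'); apply Rabs_le_between in hK.
  revert hK; generalize (1 + x + 2 * q x ^ 2); generalize (q x) (Derive q x); intros s t V hK.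
    assert (0 <= (K + V) * (s + t) ^ 2) by (apply Rmult_le_pos; [lra | apply pow2_ge_0]).
  assert (0 <= (K - V) * (s - t) ^ 2) by (apply Rmult_le_pos; [lra | apply pow2_ge_0]).
  nra.
unfold N in hN; rewrite h0, h1 in hN.
replace ((0 ^ 2 + 0 ^ 2) * exp (K * z)) with 0 in hN by ring.
pose proof (exp_pos (K * a)).
pose proof (pow2_ge_0 (q a)); pose proof (pow2_ge_0 (Derive q a)).
assert (hs : q a ^ 2 + Derive q a ^ 2 <= 0).
  apply Rnot_lt_le; intros hn.
  pose proof (Rmult_lt_0_compat _ _ hn H); lra.
apply Rsqr_0_uniq; rewrite Rsqr_pow2; lra.
Qed.

(** What is used of the Hastings-McLeod solution. The leading behaviour
    sqrt (-x/2) is weakened to 3 q^2 >= -x, which suffices for q to tend to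
    +infinity and for the linearised potential x + 6 q^2 to be at least -x far
    to the left. *)
Definition separating (q : R -> R) : Prop :=
  (forall x, solves_at q x) /\
  exists X, forall x, x < X -> 0 < q x /\ - x <= 3 * q x ^ 2.

Lemma separating_infinite (q : R -> R) : separating q -> infinite_at_left q.
Proof.
intros [_ [X hX]] M.
exists (Rmin X (- 3 * M ^ 2)); intros x hx.
pose proof (Rmin_l X (- 3 * M ^ 2)); pose proof (Rmin_r X (- 3 * M ^ 2)).
destruct (hX x) as [h1 h2]; [lra |].
apply Rnot_le_lt; intros h3; nra.
Qed.

(** To the right of a zero, q^2 either has a positive maximum, because q decays
    at +infinity, and this maximum is a forbidden critical point; or q vanishes
    identically there, hence also to the left by uniqueness for the linear
    equation q'' = (x + 2 q^2) q. *)
Lemma separating_positive (q : R -> R) : separating q -> forall x, 0 < q x.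
Proof.
intros hs z0; pose proof (separating_infinite q hs) as hinf.
destruct hs as [hq _].
apply Rnot_le_lt; intros hz0.
assert (hqc : forall x, continuity_pt q x) by (intros x; apply solves_continuity, hq).
destruct (hinf 0) as [X hX].
set (a := Rmin X z0 - 1).
assert (ha : a < X /\ a < z0).
  unfold a; pose proof (Rmin_l X z0); pose proof (Rmin_r X z0); lra.
assert (hqa : 0 < q a) by (apply hX; lra).
destruct (first_zero q a z0) as [z [hz [hqz _]]]; [lra | auto | lra | lra |].
destruct (classic (exists c, z < c /\ q c <> 0)) as [[c [hc hqc0]] | hflat].
- set (N := Rmax (c + 1) (3 / Rabs (q c) + 1)).
  assert (hac : 0 < Rabs (q c)) by (apply Rabs_pos_lt, hqc0).
  assert (hN : c < N /\ 3 / Rabs (q c) < N).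
    unfold N; pose proof (Rmax_l (c + 1) (3 / Rabs (q c) + 1));
    pose proof (Rmax_r (c + 1) (3 / Rabs (q c) + 1)); lra.
  assert (hN0 : 0 < N).
    apply Rlt_trans with (3 / Rabs (q c)); [apply Rdiv_lt_0_compat; lra | lra].
  assert (hqN : Rabs (q N) < Rabs (q c)).
    apply Rle_lt_trans with (3 / N).
      apply decay_at_right; auto.
    apply (Rmult_lt_reg_r N); [exact hN0 |].
    replace (3 / N * N) with 3 by (field; lra).
    replace 3 with (3 / Rabs (q c) * Rabs (q c)) by (field; lra).
    rewrite (Rmult_comm (Rabs (q c)) N); apply Rmult_lt_compat_r; lra.
  assert (hqN2 : q N ^ 2 < q c ^ 2).
    rewrite <- (pow2_abs (q N)), <- (pow2_abs (q c)).
    pose proof (Rabs_pos (q N)); nra.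
  set (f := fun x => q x ^ 2).
  assert (hf : forall x, is_derive f x (2 * q x * Derive q x)).
    intros x; specialize (hq x); unfold f; derive_solutions; ring.
  destruct (continuity_ab_maj f z N) as [m [hm hmI]]; [lra | |].
    intros x _; eapply is_derive_continuity_pt, hf.
  assert (hmc : q c ^ 2 <= q m ^ 2) by (apply (hm c); lra).
  assert (hqc2 : 0 < q c ^ 2) by (apply pow2_gt_0, hqc0).
  assert (hzm : z < m).
    destruct hmI as [[h | h] _]; [exact h | rewrite <- h, hqz in hmc; lra].
  assert (hmN : m < N).
    destruct hmI as [_ [h | h]]; [exact h | rewrite h in hmc; lra].
  destruct (interior_max f (fun x => 2 * q x * Derive q x) m
    (2 * Derive q m ^ 2 + 2 * q m * (m * q m + 2 * q m ^ 3)) z N) as [h1 h2].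
  + lra.
  + auto.
  + pose proof (hq m) as hqm; derive_solutions; ring.
  + intros y hy; apply hm; lra.
  + assert (hqm : q m <> 0) by (intros e; rewrite e in hmc; lra).
    assert (hdm : Derive q m = 0).
      apply Rmult_integral in h1; destruct h1 as [h1 | h1]; [lra | exact h1].
    rewrite hdm in h2.
    apply (no_trapped_critical_point q m hq hinf hdm).
    assert (0 < q m ^ 2) by lra.
    nra.
- assert (h0 : forall x, z < x -> q x = 0).
    intros x hx; apply NNPP; intros hn; apply hflat; exists x; auto.
  set (V := fun x => Rabs (1 + x + 2 * q x ^ 2)).
  destruct (continuity_ab_maj V a (z + 1)) as [m [hm _]]; [lra | |].
    intros x _; unfold V.
    apply (continuity_pt_comp (fun x => 1 + x + 2 * q x ^ 2) Rabs).
      specialize (hq x).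
      apply (is_derive_continuity_pt _ _ (1 + 4 * q x * Derive q x)).
      derive_solutions; ring.
    apply Rcontinuity_abs.
  assert (q a = 0); [| lra].
  apply (vanishing_data q a (z + 1) (V m)).
  + lra.
  + auto.
  + exact hm.
  + apply h0; lra.
  + rewrite (Derive_ext_loc q (fun _ => 0)).
      apply Derive_const.
    exists (mkposreal 1 Rlt_0_1); intros y hy.
    apply h0.
    change (Rabs (y - (z + 1)) < 1) in hy; apply Rabs_def2 in hy; lra.
Qed.

(** A positive solution is convex on [0, +infinity), so a nonnegative slope
    would prevent the decay. *)
Lemma separating_decreasing_right (q : R -> R) :
  separating q -> forall x, 0 <= x -> Derive q x < 0.
Proof.
intros hs x1 hx1; pose proof (separating_positive q hs) as hpos.
destruct hs as [hq _].
apply Rnot_le_lt; intros hd.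
assert (hqq : forall x, 0 <= x -> 0 <= x * q x + 2 * q x ^ 3).
  intros x hx; specialize (hpos x).
  assert (0 <= x * q x) by (apply Rmult_le_pos; lra).
  assert (0 < q x ^ 3) by (apply pow_lt, hpos); lra.
assert (hge : forall x, x1 <= x -> q x1 <= q x).
  intros x hx.
  apply (nondecreasing_of_derive q (Derive q)); [exact hx | |].
    intros c _; apply solves_is_derive, hq.
  intros c hc; apply Rle_trans with (1 := hd).
  apply (nondecreasing_of_derive (Derive q) (fun x => x * q x + 2 * q x ^ 3)); [lra | |].
    intros t _; apply hq.
  intros t ht; apply hqq; lra.
set (N := x1 + 1 + 3 / q x1).
pose proof (hpos x1) as hp1.
assert (hN : 0 < 3 / q x1) by (apply Rdiv_lt_0_compat; lra).
assert (hqN : Rabs (q N) <= 3 / N) by (apply decay_at_right; [auto | unfold N; lra]).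
pose proof (Rle_abs (q N)).
assert (hN1 : q x1 <= q N) by (apply hge; unfold N; lra).
assert (hlt : 3 / N < q x1); [| lra].
assert (hN0 : 3 / q x1 < N /\ 0 < N) by (unfold N; lra).
apply (Rmult_lt_reg_r N); [lra |].
replace (3 / N * N) with 3 by (field; lra).
replace 3 with (3 / q x1 * q x1) by (field; lra).
rewrite (Rmult_comm (q x1) N); apply Rmult_lt_compat_r; lra.
Qed.

(** The logarithmic derivative f = q'/q satisfies f' = x + 2 q^2 - f^2. If q' >= 0
    somewhere, then f, negative far to the left and at 0, has a nonnegative
    interior maximum; there f' = 0 gives f'' = 1 + 4 q q' > 0. *)
Lemma separating_decreasing (q : R -> R) :
  separating q -> forall x, Derive q x < 0.
Proof.
intros hs x1.
destruct (Rle_lt_dec 0 x1) as [h | hx1].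
  apply separating_decreasing_right; assumption.
pose proof (separating_positive q hs) as hpos.
pose proof (separating_infinite q hs) as hinf.
pose proof (separating_decreasing_right q hs 0 (Rle_refl 0)) as hd0.
destruct hs as [hq _].
apply Rnot_le_lt; intros hd1.
destruct (hinf (q x1)) as [X hX].
set (x3 := Rmin X x1 - 1).
assert (hx3 : x3 < X /\ x3 < x1).
  unfold x3; pose proof (Rmin_l X x1); pose proof (Rmin_r X x1); lra.
destruct (mean_value q (Derive q) x3 x1) as [c [hc e]]; [lra | |].
  intros x _; apply solves_is_derive, hq.
assert (hdc : Derive q c < 0).
  specialize (hX x3 (proj1 hx3)).
  apply Rnot_le_lt; intros h; nra.
set (f := fun x => Derive q x / q x).
set (df := fun x => x + 2 * q x ^ 2 - f x ^ 2).
assert (hf : forall x, is_derive f x (df x)).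
  intros x; unfold df, f; specialize (hq x); specialize (hpos x).
  derive_solutions; [lra | field; lra].
assert (hfneg : forall x, Derive q x < 0 -> f x < 0).
  intros x hx; unfold f, Rdiv; specialize (hpos x).
  apply Rinv_0_lt_compat in hpos; nra.
assert (hf1 : 0 <= f x1).
  unfold f, Rdiv; apply Rmult_le_pos; [exact hd1 |].
  apply Rlt_le, Rinv_0_lt_compat, hpos.
destruct (continuity_ab_maj f c 0) as [m [hm hmI]]; [lra | |].
  intros x _; eapply is_derive_continuity_pt, hf.
assert (hfm : 0 <= f m).
  apply Rle_trans with (1 := hf1), hm; lra.
assert (hmI' : c < m < 0).
  split.
    destruct hmI as [[h | h] _]; [exact h |].
    specialize (hfneg c hdc); rewrite <- h in hfm; lra.
  destruct hmI as [_ [h | h]]; [exact h |].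
  specialize (hfneg 0 hd0); rewrite h in hfm; lra.
destruct (interior_max f df m (1 + 4 * q m * Derive q m - 2 * f m * df m) c 0) as [h1 h2].
- exact hmI'.
- auto.
- unfold df at 1.
  pose proof (hq m) as hqm; pose proof (hf m) as hfd.
  auto_derive.
    repeat split; [apply hqm | eexists; exact hfd].
  rewrite (is_derive_unique (fun x : R => f x) m _ hfd).
  change (Derive (fun x => q x) m) with (Derive q m); ring.
- intros y hy; apply hm; lra.
- rewrite h1 in h2.
  assert (hdm : 0 <= Derive q m).
    apply Rnot_lt_le; intros h; specialize (hfneg m h); lra.
  specialize (hpos m).
  assert (0 <= q m * Derive q m) by (apply Rmult_le_pos; lra).
  lra.
Qed.

(** * Comparison of solutions *)

Lemma potential_lower (x q u v : R) :
  0 < q -> q <= v -> v <= u ->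
  x + 6 * q ^ 2 <= x + 2 * (u ^ 2 + u * v + v ^ 2).
Proof. intros h1 h2 h3; nra. Qed.

(** The Wronskian w' p - w p' of w = u - v and p = -q', with p' replaced by its
    value -(x q + 2 q^3). *)
Definition wronskian (q u v : R -> R) (x : R) : R :=
  (Derive u x - Derive v x) * - Derive q x + (u x - v x) * (x * q x + 2 * q x ^ 3).

Lemma is_derive_wronskian (q u v : R -> R) (x : R) :
  solves_at q x -> solves_at u x -> solves_at v x ->
  is_derive (wronskian q u v) x
    ((u x - v x) * ((2 * (u x ^ 2 + u x * v x + v x ^ 2) - 6 * q x ^ 2) * - Derive q x + q x)).
Proof.
intros hq hu hv; unfold wronskian; derive_solutions; ring.
Qed.

Lemma is_derive_ratio (q u v : R -> R) (x : R) :
  solves_at q x -> solves_at u x -> solves_at v x -> Derive q x <> 0 ->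
  is_derive (fun t => (u t - v t) / - Derive q t) x (wronskian q u v x / Derive q x ^ 2).
Proof.
intros hq hu hv h; unfold wronskian.
derive_solutions; [lra | field; exact h].
Qed.

(** Far to the left w = u - v satisfies w'' >= w > 0; being convex and bounded
    there, it cannot decrease anywhere. *)
Lemma difference_convex_left (q u v : R -> R) (X : R) :
  separating q ->
  (forall x, x < X -> solves_at u x) -> (forall x, x < X -> solves_at v x) ->
  (forall x, x < X -> q x <= v x) ->
  (exists a, forall x, x < a -> 0 < u x - v x <= 1) ->
  exists a, a < X /\ forall x, x <= a ->
    0 < u x - v x <= 1 /\
    1 <= x + 2 * (u x ^ 2 + u x * v x + v x ^ 2) /\
    0 <= Derive u x - Derive v x.
Proof.
intros hs hu hv hqv [a0 ha0].
pose proof (separating_positive q hs) as hpos.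
destruct hs as [hq [X1 hX1]].
set (a := Rmin (Rmin a0 X) (Rmin X1 (-1)) - 1).
assert (ha : a < a0 /\ a < X /\ a < X1 /\ a < -1).
  unfold a; pose proof (Rmin_l (Rmin a0 X) (Rmin X1 (-1)));
  pose proof (Rmin_r (Rmin a0 X) (Rmin X1 (-1))); pose proof (Rmin_l a0 X);
  pose proof (Rmin_r a0 X); pose proof (Rmin_l X1 (-1)); pose proof (Rmin_r X1 (-1)); lra.
assert (hV : forall x, x <= a -> 1 <= x + 2 * (u x ^ 2 + u x * v x + v x ^ 2)).
  intros x hx.
  pose proof (potential_lower x (q x) (u x) (v x) (hpos x) (hqv x ltac:(lra))) as h.
  destruct (ha0 x ltac:(lra)); destruct (hX1 x ltac:(lra)).
  specialize (h ltac:(lra)); lra.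
exists a; split; [lra |].
intros x hx; split; [apply ha0; lra | split; [apply hV, hx |]].
apply Rnot_lt_le; intros hneg.
(* Over the length T, a slope as negative as the one at x makes w drop by 2, but 0 < w <= 1. *)
set (T := (1 + 1) / - (Derive u x - Derive v x)).
assert (hT : 0 < T) by (apply Rdiv_lt_0_compat; lra).
assert (hstep : (u x - v x) - (u (x - T) - v (x - T)) <= (Derive u x - Derive v x) * T).
  destruct (mean_value (fun t => u t - v t) (fun t => Derive u t - Derive v t) (x - T) x)
    as [c [hc e]]; [lra | |].
    intros t ht; pose proof (hu t ltac:(lra)) as hut; pose proof (hv t ltac:(lra)) as hvt.
    derive_solutions; ring.
  rewrite e; replace (x - (x - T)) with T by ring.
  apply Rmult_le_compat_r; [lra |].
  apply (nondecreasing_of_derive (fun t => Derive u t - Derive v t)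
    (fun t => (t + 2 * (u t ^ 2 + u t * v t + v t ^ 2)) * (u t - v t))); [lra | |].
    intros t ht; pose proof (hu t ltac:(lra)) as hut; pose proof (hv t ltac:(lra)) as hvt.
    derive_solutions; ring.
  intros t ht; specialize (hV t ltac:(lra)); destruct (ha0 t ltac:(lra)).
  apply Rmult_le_pos; lra.
replace ((Derive u x - Derive v x) * T) with (- (1 + 1)) in hstep by (unfold T; field; lra).
destruct (ha0 x ltac:(lra)); destruct (ha0 (x - T) ltac:(lra)); lra.
Qed.

(** The Wronskian is nondecreasing, so if it is nonpositive somewhere, then w/p is
    nonincreasing on the left of that point and w >= r p = -r q' there for some r > 0. Since
    w'' >= w far to the left, w' + r q is nondecreasing there, hence bounded above at
    -infinity; but w' >= 0 and q is unbounded. *)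
Lemma wronskian_positive (q u v : R -> R) (X : R) :
  separating q ->
  (forall x, x < X -> solves_at u x) -> (forall x, x < X -> solves_at v x) ->
  (forall x, x < X -> q x <= v x) -> (forall x, x < X -> v x < u x) ->
  (exists a, forall x, x < a -> u x - v x <= 1) ->
  forall x, x < X -> 0 < wronskian q u v x.
Proof.
intros hs hu hv hqv huv [a0 ha0] x1 hx1.
pose proof (separating_positive q hs) as hpos.
pose proof (separating_decreasing q hs) as hdec.
pose proof (separating_infinite q hs) as hinf.
destruct (difference_convex_left q u v X hs hu hv hqv) as [a [haX ha]].
  exists (Rmin a0 X); intros x hx.
  pose proof (Rmin_l a0 X); pose proof (Rmin_r a0 X).
  split; [specialize (huv x) | apply ha0]; lra.
destruct hs as [hq _].
apply Rnot_le_lt; intros hW.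
assert (hWneg : forall x, x <= x1 -> wronskian q u v x <= 0).
  intros x hx; apply Rle_trans with (2 := hW).
  apply (nondecreasing_of_derive _ (fun x =>
    (u x - v x) * ((2 * (u x ^ 2 + u x * v x + v x ^ 2) - 6 * q x ^ 2) * - Derive q x + q x)));
    [exact hx | |].
    intros c hc; apply is_derive_wronskian; [auto | apply hu; lra | apply hv; lra].
  intros c hc.
  specialize (huv c ltac:(lra)); specialize (hqv c ltac:(lra)).
  specialize (hpos c); specialize (hdec c).
  pose proof (potential_lower c (q c) (u c) (v c) hpos hqv ltac:(lra)).
  apply Rmult_le_pos; [lra |].
  assert (0 <= (2 * (u c ^ 2 + u c * v c + v c ^ 2) - 6 * q c ^ 2) * - Derive q c); [| lra].
  apply Rmult_le_pos; lra.
set (r := (u x1 - v x1) / - Derive q x1).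
assert (hr : 0 < r).
  apply Rdiv_lt_0_compat; [specialize (huv x1 hx1) | specialize (hdec x1)]; lra.
assert (hw : forall x, x <= x1 -> r * - Derive q x <= u x - v x).
  intros x hx.
  assert (h : r <= (u x - v x) / - Derive q x).
    unfold r.
    apply Ropp_le_cancel.
    apply (nondecreasing_of_derive (fun t => - ((u t - v t) / - Derive q t))
      (fun t => - (wronskian q u v t / Derive q t ^ 2))); [exact hx | |].
      intros c hc; apply (is_derive_opp (fun t => (u t - v t) / - Derive q t)).
      apply is_derive_ratio; [auto | apply hu; lra | apply hv; lra |].
      specialize (hdec c); lra.
    intros c hc; specialize (hWneg c ltac:(lra)).
    assert (0 < Derive q c ^ 2) by (apply pow2_gt_0; specialize (hdec c); lra).
    assert (0 < / Derive q c ^ 2) by (apply Rinv_0_lt_compat; assumption).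
    unfold Rdiv; nra.
  specialize (hdec x).
  replace (u x - v x) with ((u x - v x) / - Derive q x * - Derive q x) by (field; lra).
  apply Rmult_le_compat_r; lra.
set (b := Rmin a x1).
assert (hb : b <= a /\ b <= x1) by (unfold b; pose proof (Rmin_l a x1); pose proof (Rmin_r a x1); lra).
set (F := fun t => Derive u t - Derive v t + r * q t).
destruct (hinf (F b / r)) as [Y hY].
set (x := Rmin Y b - 1).
assert (hx : x < Y /\ x < b) by (unfold x; pose proof (Rmin_l Y b); pose proof (Rmin_r Y b); lra).
assert (hF : F x <= F b).
  apply (nondecreasing_of_derive F (fun t =>
    (t + 2 * (u t ^ 2 + u t * v t + v t ^ 2)) * (u t - v t) + r * Derive q t)); [lra | |].
    intros t ht; pose proof (hu t ltac:(lra)) as hut; pose proof (hv t ltac:(lra)) as hvt.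
    pose proof (hq t) as hqt; unfold F; derive_solutions; ring.
  intros t ht; destruct (ha t ltac:(lra)) as [h1 [h2 _]].
  specialize (hw t ltac:(lra)); nra.
specialize (hY x (proj1 hx)).
destruct (ha x ltac:(lra)) as [_ [_ hdx]].
assert (F b < r * q x).
  replace (F b) with (F b / r * r) by (field; lra).
  rewrite (Rmult_comm r); apply Rmult_lt_compat_r; assumption.
unfold F in hF at 1; lra.
Qed.

Lemma ratio_nondecreasing (q u v : R -> R) (a b : R) :
  separating q -> a <= b ->
  (forall x, a <= x <= b -> solves_at u x) -> (forall x, a <= x <= b -> solves_at v x) ->
  (forall x, a < x < b -> 0 < wronskian q u v x) ->
  (u a - v a) / - Derive q a <= (u b - v b) / - Derive q b.
Proof.
intros hs hab hu hv hW.
pose proof (separating_decreasing q hs) as hdec.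
destruct hs as [hq _].
apply (nondecreasing_of_derive (fun t => (u t - v t) / - Derive q t)
  (fun t => wronskian q u v t / Derive q t ^ 2)); [exact hab | |].
  intros c hc; apply is_derive_ratio; auto.
  specialize (hdec c); lra.
intros c hc; specialize (hW c hc).
apply Rlt_le, Rdiv_lt_0_compat; [exact hW |].
apply pow2_gt_0; specialize (hdec c); lra.
Qed.

(** At a first zero of u - v the increasing ratio (u - v)/p would vanish. *)
Lemma comparison (q u v : R -> R) (X : R) :
  separating q ->
  (forall x, x < X -> solves_at u x) -> (forall x, x < X -> solves_at v x) ->
  (forall x, x < X -> q x <= v x) ->
  (exists a, forall x, x < a -> 0 < u x - v x <= 1) ->
  forall x, x < X -> v x < u x.
Proof.
intros hs hu hv hqv [a0 ha0] x hx.
apply Rnot_le_lt; intros hle.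
set (a := Rmin a0 x - 1).
assert (ha : a < a0 /\ a < x) by (unfold a; pose proof (Rmin_l a0 x); pose proof (Rmin_r a0 x); lra).
destruct (first_zero (fun t => u t - v t) a x) as [z [hz [hz0 hzpos]]].
- lra.
- intros t ht; apply (continuity_pt_minus u v); apply solves_continuity;
    [apply hu | apply hv]; lra.
- apply ha0; lra.
- lra.
- assert (hpos : forall t, t < z -> v t < u t).
    intros t ht; destruct (Rlt_le_dec t a) as [h | h].
      destruct (ha0 t); lra.
    specialize (hzpos t (conj h ht)); lra.
  assert (hW : forall t, t < z -> 0 < wronskian q u v t).
    apply wronskian_positive; auto.
    + intros t ht; apply hu; lra.
    + intros t ht; apply hv; lra.
    + intros t ht; apply hqv; lra.
    + exists a0; intros t ht; apply ha0, ht.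
  pose proof (ratio_nondecreasing q u v a z hs) as h.
  assert (h1 : 0 < (u a - v a) / - Derive q a).
    apply Rdiv_lt_0_compat; [apply ha0; lra |].
    pose proof (separating_decreasing q hs a); lra.
  assert (h2 : (u z - v z) / - Derive q z = 0) by (rewrite hz0; unfold Rdiv; ring).
  rewrite h2 in h.
  assert ((u a - v a) / - Derive q a <= 0); [| lra].
  apply h; [lra | | |].
  + intros t ht; apply hu; lra.
  + intros t ht; apply hv; lra.
  + intros t ht; apply hW; lra.
Qed.

(** Both solutions decay at +infinity, so the convex difference w has w' <= 0 on
    [0, +infinity). The Wronskian stays above a positive constant c, and its term
    w' p is nonpositive; so w q'' >= c, and q'' is bounded below by a positive
    constant. The decreasing function q cannot be that convex. *)
Lemma no_other_global_solution (q u : R -> R) :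
  separating q -> (forall x, solves_at u x) ->
  (exists a, forall x, x < a -> 0 < u x - q x <= 1) -> False.
Proof.
intros hs hu hleft.
pose proof (separating_positive q hs) as hpos.
pose proof (separating_decreasing q hs) as hdec.
assert (hqs := proj1 hs).
assert (huq : forall x, q x < u x).
  intros x; apply (comparison q u q (x + 1)); auto; try (intros; lra).
assert (hW : forall x, 0 < wronskian q u q x).
  intros x; apply (wronskian_positive q u q (x + 1)); auto; try (intros; lra).
  destruct hleft as [a ha]; exists a; intros y hy; apply ha, hy.
assert (hV : forall x, 0 <= x -> 0 <= (x + 2 * (u x ^ 2 + u x * q x + q x ^ 2)) * (u x - q x)).
  intros x hx; specialize (hpos x); specialize (huq x).
  assert (0 < u x) by lra.
  apply Rmult_le_pos; [nra | lra].
assert (hdw : forall x, is_derive (fun t => u t - q t) x (Derive u x - Derive q x)).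
  intros x; pose proof (hu x) as h1; pose proof (hqs x) as h2; derive_solutions; ring.
assert (hddw : forall x, is_derive (fun t => Derive u t - Derive q t) x
    ((x + 2 * (u x ^ 2 + u x * q x + q x ^ 2)) * (u x - q x))).
  intros x; pose proof (hu x) as h1; pose proof (hqs x) as h2; derive_solutions; ring.
assert (hw' : forall x, 0 <= x -> Derive u x - Derive q x <= 0).
  intros x hx; apply Rnot_lt_le; intros hn.
  set (N := x + 1 + 3 / (u x - q x)).
  assert (h0 : 0 < u x - q x) by (specialize (huq x); lra).
  assert (h3 : 0 < 3 / (u x - q x)) by (apply Rdiv_lt_0_compat; lra).
  assert (hN : x < N /\ 0 < N /\ 3 / (u x - q x) < N) by (unfold N; lra).
  assert (h1 : u x - q x <= u N - q N).
    apply (nondecreasing_of_derive (fun t => u t - q t) (fun t => Derive u t - Derive q t));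
      [lra | auto |].
    intros c hc; apply Rle_trans with (Derive u x - Derive q x); [lra |].
    apply (nondecreasing_of_derive (fun t => Derive u t - Derive q t) (fun x =>
      (x + 2 * (u x ^ 2 + u x * q x + q x ^ 2)) * (u x - q x))); [lra | auto |].
    intros t ht; apply hV; lra.
  assert (h2 : Rabs (u N) <= 3 / N) by (apply decay_at_right; [auto | lra]).
  pose proof (Rle_abs (u N)); specialize (hpos N).
  assert (3 / N < u x - q x); [| lra].
  apply (Rmult_lt_reg_r N); [lra |].
  replace (3 / N * N) with 3 by (field; lra).
  replace 3 with (3 / (u x - q x) * (u x - q x)) by (field; lra).
  rewrite (Rmult_comm (u x - q x) N); apply Rmult_lt_compat_r; lra.
set (w0 := u 0 - q 0).
assert (hw0 : 0 < w0) by (unfold w0; specialize (huq 0); lra).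
set (c := wronskian q u q 0).
assert (hc : 0 < c) by apply hW.
assert (hqq : forall x, 0 <= x -> c / w0 <= x * q x + 2 * q x ^ 3).
  intros x hx.
  assert (h1 : c <= wronskian q u q x).
    apply (nondecreasing_of_derive _ (fun x =>
      (u x - q x) * ((2 * (u x ^ 2 + u x * q x + q x ^ 2) - 6 * q x ^ 2) * - Derive q x + q x)));
      [exact hx | |].
      intros t _; apply is_derive_wronskian; auto.
    intros t ht; specialize (huq t); specialize (hpos t); specialize (hdec t).
    pose proof (potential_lower t (q t) (u t) (q t) hpos (Rle_refl _) ltac:(lra)).
    apply Rmult_le_pos; [lra |].
    assert (0 <= (2 * (u t ^ 2 + u t * q t + q t ^ 2) - 6 * q t ^ 2) * - Derive q t); [| lra].
    apply Rmult_le_pos; lra.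
  assert (h2 : u x - q x <= w0).
    apply Ropp_le_cancel; unfold w0.
    apply (nondecreasing_of_derive (fun t => - (u t - q t)) (fun t => - (Derive u t - Derive q t)));
      [exact hx | |].
      intros t _; apply (is_derive_opp (fun t => u t - q t)), hdw.
    intros t ht; specialize (hw' t ltac:(lra)); lra.
  assert (h3 : c <= (u x - q x) * (x * q x + 2 * q x ^ 3)).
    unfold wronskian in h1; specialize (hw' x hx); specialize (hdec x); nra.
  assert (h4 : 0 <= x * q x + 2 * q x ^ 3).
    specialize (hpos x); assert (0 < q x ^ 3) by (apply pow_lt, hpos); nra.
  apply (Rmult_le_reg_r w0); [exact hw0 |].
  replace (c / w0 * w0) with c by (field; lra).
  specialize (huq x); nra.
set (m := c / w0) in *.
assert (hm : 0 < m) by (apply Rdiv_lt_0_compat; assumption).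
(* The length after which q'' >= m brings q back to its value at 0. *)
set (T := - 2 * Derive q 0 / m).
assert (hT : 0 < T).
  unfold T; apply Rdiv_lt_0_compat; [specialize (hdec 0) |]; lra.
pose proof (taylor_lower_right q (Derive q) (fun x => x * q x + 2 * q x ^ 3) 0 T m) as ht.
assert (q 0 + Derive q 0 * (T - 0) + m * (T - 0) ^ 2 / 2 <= q T).
  apply ht; [lra | | |].
  - intros x _; apply solves_is_derive, hqs.
  - intros x _; apply hqs.
  - intros x hx; apply hqq; lra.
replace (q 0 + Derive q 0 * (T - 0) + m * (T - 0) ^ 2 / 2) with (q 0) in H
  by (unfold T; field; lra).
assert (- q 0 < - q T); [| lra].
apply (increasing_of_derive (fun t => - q t) (fun t => - Derive q t)); [exact hT | |].
  intros x _; apply (is_derive_opp q), solves_is_derive, hqs.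
intros x _; specialize (hdec x); lra.
Qed.

(** * One-parameter families ending at poles *)

(** States w = b g (1 + o(1)) at -infinity; for b = 0 it only says that w is
    negligible with respect to g. *)
Definition asymptotic_to (g : R -> R) (b : R) (w : R -> R) : Prop :=
  forall eps, 0 < eps -> exists X, forall x, x < X -> Rabs (w x - b * g x) <= eps * g x.

Definition gauge (g : R -> R) : Prop :=
  (forall x, 0 < g x) /\ forall eps, 0 < eps -> exists X, forall x, x < X -> g x < eps.

Lemma asymptotic_to_minus (g w1 w2 : R -> R) (b1 b2 : R) :
  asymptotic_to g b1 w1 -> asymptotic_to g b2 w2 ->
  asymptotic_to g (b2 - b1) (fun x => w2 x - w1 x).
Proof.
intros h1 h2 eps he.
destruct (h1 (eps / 2)) as [X1 hX1]; [lra |].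
destruct (h2 (eps / 2)) as [X2 hX2]; [lra |].
exists (Rmin X1 X2); intros x hx.
pose proof (Rmin_l X1 X2); pose proof (Rmin_r X1 X2).
specialize (hX1 x ltac:(lra)); specialize (hX2 x ltac:(lra)).
apply Rabs_le; apply Rabs_le_between in hX1; apply Rabs_le_between in hX2; lra.
Qed.

Lemma asymptotic_to_small (g w : R -> R) (b : R) :
  gauge g -> asymptotic_to g b w -> 0 < b ->
  forall eps, 0 < eps -> exists X, forall x, x < X -> 0 < w x <= eps.
Proof.
intros [hg0 hg] hw hb eps he.
destruct (hw (b / 2)) as [X1 hX1]; [lra |].
destruct (hg (eps / (2 * b))) as [X2 hX2]; [apply Rdiv_lt_0_compat; lra |].
exists (Rmin X1 X2); intros x hx.
pose proof (Rmin_l X1 X2); pose proof (Rmin_r X1 X2).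
specialize (hX1 x ltac:(lra)); specialize (hX2 x ltac:(lra)); specialize (hg0 x).
apply Rabs_le_between in hX1.
assert (hgb : b * g x < eps / 2).
  replace (eps / 2) with (b * (eps / (2 * b))) by (field; lra).
  apply Rmult_lt_compat_l; lra.
assert (0 < b * g x) by (apply Rmult_lt_0_compat; lra).
lra.
Qed.

(** The last field contains both the residue -1 and the vanishing of the constant
    term of the Laurent expansion at the first pole. *)
Record pole_family (g : R -> R) (Y : R -> R -> R) (sigma : R -> R) : Prop := {
  pf_gauge : gauge g;
  pf_base : separating (Y 0);
  pf_solves : forall b x, 0 < b -> x < sigma b -> solves_at (Y b) x;
  pf_asymptotic : forall b, 0 <= b -> asymptotic_to g b (fun x => Y b x - Y 0 x);
  pf_pole : forall b, 0 < b -> forall eps, 0 < eps -> exists d, 0 < d /\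
    forall x, sigma b - d < x < sigma b -> Rabs (Y b x - / (sigma b - x)) < eps }.

(** The member with parameter 0 is analytic on the whole axis, which a real
    number sigma 0 cannot express. *)
Definition regular (sigma : R -> R) (b x : R) : Prop := b = 0 \/ x < sigma b.

Section Family.
Context {g : R -> R} {Y : R -> R -> R} {sigma : R -> R}.
Context (F : pole_family g Y sigma).

Lemma regular_solves (b x : R) : 0 <= b -> regular sigma b x -> solves_at (Y b) x.
Proof.
intros hb [-> | hx]; [apply (pf_base _ _ _ F) |].
destruct (Req_dec b 0) as [-> | hne]; [apply (pf_base _ _ _ F) |].
apply (pf_solves _ _ _ F); lra.
Qed.

Lemma regular_left (b x y : R) : x <= y -> regular sigma b y -> regular sigma b x.
Proof. intros hxy [h | h]; [left; exact h | right; lra]. Qed.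

Lemma members_asymptotic (b1 b2 : R) :
  0 <= b1 -> 0 <= b2 -> asymptotic_to g (b2 - b1) (fun x => Y b2 x - Y b1 x).
Proof.
intros h1 h2 eps he.
destruct (asymptotic_to_minus g _ _ _ _ (pf_asymptotic _ _ _ F b1 h1)
  (pf_asymptotic _ _ _ F b2 h2) eps he) as [X hX].
exists X; intros x hx; specialize (hX x hx).
replace (Y b2 x - Y b1 x) with (Y b2 x - Y 0 x - (Y b1 x - Y 0 x)) by ring; exact hX.
Qed.

Lemma members_left (b1 b2 : R) :
  0 <= b1 < b2 -> forall eps, 0 < eps ->
  exists X, forall x, x < X -> 0 < Y b2 x - Y b1 x <= eps.
Proof.
intros h; apply (asymptotic_to_small g _ (b2 - b1)).
- apply (pf_gauge _ _ _ F).
- apply members_asymptotic; lra.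
- lra.
Qed.

Lemma base_positive (x : R) : 0 < Y 0 x.
Proof. apply separating_positive, (pf_base _ _ _ F). Qed.

Lemma base_below (b x : R) : 0 <= b -> regular sigma b x -> Y 0 x <= Y b x.
Proof.
intros hb hx.
destruct (Req_dec b 0) as [-> | hne]; [apply Rle_refl |].
destruct hx as [hx | hx]; [contradiction |].
apply Rlt_le.
apply (comparison (Y 0) (Y b) (Y 0) (sigma b)); auto.
- apply (pf_base _ _ _ F).
- intros t ht; apply (pf_solves _ _ _ F); lra.
- intros t _; apply (pf_base _ _ _ F).
- intros t _; apply Rle_refl.
- apply members_left; lra.
Qed.

Lemma ordered_where_regular (b1 b2 X : R) :
  0 <= b1 < b2 ->
  (forall x, x < X -> regular sigma b1 x) -> (forall x, x < X -> regular sigma b2 x) ->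
  forall x, x < X -> Y b1 x < Y b2 x.
Proof.
intros hb h1 h2.
apply (comparison (Y 0)).
- apply (pf_base _ _ _ F).
- intros x hx; apply regular_solves; [lra | auto].
- intros x hx; apply regular_solves; [lra | auto].
- intros x hx; apply base_below; [lra | auto].
- apply members_left; [lra | apply Rlt_0_1].
Qed.

Lemma blow_up (b M x0 : R) :
  0 < b -> x0 < sigma b -> exists x, x0 < x < sigma b /\ M < Y b x.
Proof.
intros hb hx0.
destruct (pf_pole _ _ _ F b hb 1 Rlt_0_1) as [d [hd0 hd]].
set (e := Rmin (Rmin d (sigma b - x0)) (/ (Rabs M + 1))).
pose proof (Rabs_pos M) as hM.
assert (he : 0 < e).
  unfold e; repeat apply Rmin_glb_lt; try lra.
  apply Rinv_0_lt_compat; lra.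
assert (he1 : e <= d /\ e <= sigma b - x0 /\ e <= / (Rabs M + 1)).
  unfold e; pose proof (Rmin_l (Rmin d (sigma b - x0)) (/ (Rabs M + 1)));
  pose proof (Rmin_r (Rmin d (sigma b - x0)) (/ (Rabs M + 1)));
  pose proof (Rmin_l d (sigma b - x0)); pose proof (Rmin_r d (sigma b - x0)); lra.
exists (sigma b - e / 2); split; [lra |].
specialize (hd (sigma b - e / 2) ltac:(lra)).
replace (sigma b - (sigma b - e / 2)) with (e / 2) in hd by ring.
apply Rabs_def2 in hd.
assert (h : Rabs M + 1 <= / e).
  rewrite <- (Rinv_inv (Rabs M + 1)); apply Rinv_le_contravar; lra.
replace (/ (e / 2)) with (2 * / e) in hd by (field; lra).
pose proof (Rle_abs M); lra.
Qed.

(** If the smaller parameter had an earlier pole, the larger member would be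
    squeezed to infinity at a point where it is continuous. If the poles coincide,
    the difference of the members tends to 0 there, whereas its increasing ratio
    to -q' is bounded below and q' does not vanish at the pole. *)
Lemma sigma_decreasing (b1 b2 : R) : 0 < b1 -> b1 < b2 -> sigma b2 < sigma b1.
Proof.
intros hb1 hb.
apply Rnot_le_lt; intros hle.
assert (hord : forall x, x < sigma b1 -> Y b1 x < Y b2 x).
  apply ordered_where_regular; [lra | |]; intros x hx; right; lra.
destruct hle as [hlt | heq].
- destruct (continuity_pt_near (Y b2) (sigma b1) 1) as [d [hd0 hd]]; [| lra |].
    apply solves_continuity, (pf_solves _ _ _ F); lra.
  destruct (blow_up b1 (Y b2 (sigma b1) + 1) (sigma b1 - d)) as [x [hx hx1]]; [lra | lra |].
  specialize (hord x ltac:(lra)).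
  specialize (hd x); rewrite Rabs_left in hd by lra.
  specialize (hd ltac:(lra)); apply Rabs_def2 in hd; lra.
- pose proof (separating_decreasing _ (pf_base _ _ _ F)) as hdec.
  pose proof (proj1 (pf_base _ _ _ F)) as hq.
  set (s := sigma b1) in *.
  set (r := (Y b2 (s - 1) - Y b1 (s - 1)) / - Derive (Y 0) (s - 1)).
  assert (hr : 0 < r).
    apply Rdiv_lt_0_compat; [specialize (hord (s - 1)) | specialize (hdec (s - 1))]; lra.
  assert (hlow : forall x, s - 1 <= x < s -> r * - Derive (Y 0) x <= Y b2 x - Y b1 x).
    intros x hx.
    pose proof (hdec x) as hdx.
    replace (Y b2 x - Y b1 x)
      with ((Y b2 x - Y b1 x) / - Derive (Y 0) x * - Derive (Y 0) x) by (field; lra).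
    apply Rmult_le_compat_r; [lra |].
    apply (ratio_nondecreasing (Y 0)); [apply (pf_base _ _ _ F) | lra | | |].
    + intros t ht; apply (pf_solves _ _ _ F); fold s; lra.
    + intros t ht; apply (pf_solves _ _ _ F); fold s; lra.
    + intros t ht; apply (wronskian_positive _ _ _ s); auto; try lra.
      * apply (pf_base _ _ _ F).
      * intros y hy; apply (pf_solves _ _ _ F); fold s; lra.
      * intros y hy; apply (pf_solves _ _ _ F); fold s; lra.
      * intros y hy; apply base_below; [lra | right; fold s; lra].
      * destruct (members_left b1 b2 ltac:(lra) 1 Rlt_0_1) as [a ha].
        exists a; intros y hy; apply ha, hy.
  destruct (continuity_pt_near (Derive (Y 0)) s (- Derive (Y 0) s / 2)) as [d0 [hd00 hd0]].
    eapply is_derive_continuity_pt, (proj2 (hq s)).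
    specialize (hdec s); lra.
  set (eps := r * (- Derive (Y 0) s / 2) / 2).
  assert (heps : 0 < eps).
    unfold eps; specialize (hdec s).
    apply Rdiv_lt_0_compat; [apply Rmult_lt_0_compat |]; lra.
  destruct (pf_pole _ _ _ F b1 hb1 eps heps) as [d1 [hd10 hd1]].
  destruct (pf_pole _ _ _ F b2 ltac:(lra) eps heps) as [d2 [hd20 hd2]].
  fold s in hd1; rewrite <- heq in hd2.
  set (e := Rmin (Rmin d0 1) (Rmin d1 d2)).
  assert (he : 0 < e) by (unfold e; repeat apply Rmin_glb_lt; lra).
  assert (he1 : e <= d0 /\ e <= 1 /\ e <= d1 /\ e <= d2).
    unfold e; pose proof (Rmin_l (Rmin d0 1) (Rmin d1 d2));
    pose proof (Rmin_r (Rmin d0 1) (Rmin d1 d2)); pose proof (Rmin_l d0 1);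
    pose proof (Rmin_r d0 1); pose proof (Rmin_l d1 d2); pose proof (Rmin_r d1 d2); lra.
  set (x := s - e / 2).
  assert (hx : s - e < x < s) by (unfold x; lra).
  specialize (hlow x ltac:(lra)).
  specialize (hd1 x ltac:(lra)); specialize (hd2 x ltac:(lra)).
  specialize (hd0 x); rewrite Rabs_left in hd0 by lra.
  specialize (hd0 ltac:(lra)).
  apply Rabs_def2 in hd0; apply Rabs_def2 in hd1; apply Rabs_def2 in hd2.
  assert (2 * eps <= r * - Derive (Y 0) x); [| lra].
  unfold eps; replace (2 * (r * (- Derive (Y 0) s / 2) / 2)) with (r * (- Derive (Y 0) s / 2)) by field.
  apply Rmult_le_compat_l; lra.
Qed.

Lemma regular_antitone (b1 b2 x : R) : 0 <= b1 < b2 -> x < sigma b2 -> regular sigma b1 x.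
Proof.
intros hb hx.
destruct (Req_dec b1 0) as [e | hne]; [left; exact e | right].
assert (sigma b2 < sigma b1) by (apply sigma_decreasing; lra); lra.
Qed.

Lemma ordered (b1 b2 x : R) : 0 <= b1 < b2 -> x < sigma b2 -> Y b1 x < Y b2 x.
Proof.
intros hb; apply ordered_where_regular; [exact hb | |].
  intros t ht; apply (regular_antitone b1 b2); assumption.
intros t ht; right; exact ht.
Qed.

(** For w1 = y_b2 - y_b1 and w2 = y_b3 - y_b2 the potential of w2 dominates that
    of w1, so the Wronskian w2' w1 - w2 w1' is nondecreasing; it tends to 0 at
    -infinity, hence is nonnegative and w2/w1 is nondecreasing. The limit of
    this ratio at -infinity is (b3 - b2)/(b2 - b1). *)
Lemma convex_in_parameter (b1 b2 b3 x : R) :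
  0 <= b1 -> b1 < b2 -> b2 < b3 -> x < sigma b3 ->
  (b3 - b2) * (Y b2 x - Y b1 x) <= (b2 - b1) * (Y b3 x - Y b2 x).
Proof.
intros hb1 hb12 hb23 hx.
set (X := sigma b3) in *.
assert (hs1 : forall t, t < X -> solves_at (Y b1) t).
  intros t ht; apply regular_solves; [lra | apply (regular_antitone b1 b3); [lra | exact ht]].
assert (hs2 : forall t, t < X -> solves_at (Y b2) t).
  intros t ht; apply regular_solves; [lra | apply (regular_antitone b2 b3); [lra | exact ht]].
assert (hs3 : forall t, t < X -> solves_at (Y b3) t).
  intros t ht; apply (pf_solves _ _ _ F); [lra | exact ht].
assert (h01 : forall t, t < X -> Y 0 t <= Y b1 t).
  intros t ht; apply base_below; [lra | apply (regular_antitone b1 b3); [lra | exact ht]].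
assert (h12 : forall t, t < X -> Y b1 t < Y b2 t).
  apply ordered_where_regular; [lra | |]; intros t ht;
    [apply (regular_antitone b1 b3) | apply (regular_antitone b2 b3)]; lra || exact ht.
assert (h23 : forall t, t < X -> Y b2 t < Y b3 t).
  intros t ht; apply ordered; [lra | exact ht].
set (K := fun t => (Derive (Y b3) t - Derive (Y b2) t) * (Y b2 t - Y b1 t)
  - (Y b3 t - Y b2 t) * (Derive (Y b2) t - Derive (Y b1) t)).
assert (hK : forall t, t < X -> is_derive K t (2 * (Y b3 t - Y b2 t) * (Y b2 t - Y b1 t) *
    (Y b3 t ^ 2 + Y b3 t * Y b2 t - Y b2 t * Y b1 t - Y b1 t ^ 2))).
  intros t ht; pose proof (hs1 t ht); pose proof (hs2 t ht); pose proof (hs3 t ht).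
  unfold K; derive_solutions; ring.
assert (hK' : forall t, t < X -> 0 <= 2 * (Y b3 t - Y b2 t) * (Y b2 t - Y b1 t) *
    (Y b3 t ^ 2 + Y b3 t * Y b2 t - Y b2 t * Y b1 t - Y b1 t ^ 2)).
  intros t ht; pose proof (base_positive t).
  specialize (h01 t ht); specialize (h12 t ht); specialize (h23 t ht).
  apply Rmult_le_pos; [apply Rmult_le_pos; lra |]; nra.
assert (hKpos : forall t, t < X -> 0 <= K t).
  intros t ht; apply Rnot_lt_le; intros hn.
  destruct (difference_convex_left (Y 0) (Y b2) (Y b1) X) as [a12 [ha12X ha12]]; auto.
    apply (pf_base _ _ _ F).
    apply members_left; lra.
  destruct (difference_convex_left (Y 0) (Y b3) (Y b2) X) as [a23 [ha23X ha23]]; auto.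
    apply (pf_base _ _ _ F).
    intros y hy; specialize (h01 y hy); specialize (h12 y hy); lra.
    apply members_left; lra.
  destruct (members_left b1 b2 ltac:(lra) (- K t / 2)) as [a ha]; [lra |].
  set (y := Rmin (Rmin a t) (Rmin a12 a23) - 2).
  assert (hy : y + 1 < a /\ y < t /\ y + 1 < a12 /\ y < a23).
    unfold y; pose proof (Rmin_l (Rmin a t) (Rmin a12 a23));
    pose proof (Rmin_r (Rmin a t) (Rmin a12 a23)); pose proof (Rmin_l a t);
    pose proof (Rmin_r a t); pose proof (Rmin_l a12 a23); pose proof (Rmin_r a12 a23); lra.
  assert (hKy : K y <= K t).
    apply (nondecreasing_of_derive K _ y t (Rlt_le _ _ (proj1 (proj2 hy)))
      (fun c hc => hK c ltac:(lra))).
    intros c hc; apply hK'; lra.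
  assert (hslope : Derive (Y b2) y - Derive (Y b1) y <= - K t / 2).
    pose proof (taylor_lower_right (fun t => Y b2 t - Y b1 t)
      (fun t => Derive (Y b2) t - Derive (Y b1) t)
      (fun t => (t + 2 * (Y b2 t ^ 2 + Y b2 t * Y b1 t + Y b1 t ^ 2)) * (Y b2 t - Y b1 t))
      y (y + 1) 0) as h.
    cbv beta in h; replace (y + 1 - y) with 1 in h by ring.
    destruct (ha (y + 1) ltac:(lra)); destruct (ha y ltac:(lra)).
    assert (Y b2 y - Y b1 y + (Derive (Y b2) y - Derive (Y b1) y) * 1 + 0 * 1 ^ 2 / 2 <=
      Y b2 (y + 1) - Y b1 (y + 1)); [| lra].
    apply h; [lra | | |]; intros c hc.
    - pose proof (hs1 c ltac:(lra)); pose proof (hs2 c ltac:(lra)); derive_solutions; ring.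
    - pose proof (hs1 c ltac:(lra)); pose proof (hs2 c ltac:(lra)); derive_solutions; ring.
    - destruct (ha12 c ltac:(lra)) as [h1 [h2 _]]; apply Rmult_le_pos; lra.
  destruct (ha12 y ltac:(lra)) as [h1 [_ h2]].
  destruct (ha23 y ltac:(lra)) as [h3 [_ h4]].
  unfold K in hKy at 1; nra.
apply Rnot_lt_le; intros hn.
set (r := (Y b3 x - Y b2 x) / (Y b2 x - Y b1 x)).
assert (hr : 0 < r).
  apply Rdiv_lt_0_compat; [specialize (h23 x hx) | specialize (h12 x hx)]; lra.
assert (hlow : forall t, t <= x -> Y b3 t - Y b2 t <= r * (Y b2 t - Y b1 t)).
  intros t ht.
  assert (h0 : 0 < Y b2 t - Y b1 t) by (specialize (h12 t ltac:(lra)); lra).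
  replace (Y b3 t - Y b2 t) with ((Y b3 t - Y b2 t) / (Y b2 t - Y b1 t) * (Y b2 t - Y b1 t))
    by (field; lra).
  apply Rmult_le_compat_r; [lra |].
  apply (nondecreasing_of_derive (fun t => (Y b3 t - Y b2 t) / (Y b2 t - Y b1 t))
    (fun t => K t / (Y b2 t - Y b1 t) ^ 2)); [exact ht | |].
    intros c hc; pose proof (hs1 c ltac:(lra)); pose proof (hs2 c ltac:(lra)).
    pose proof (hs3 c ltac:(lra)); specialize (h12 c ltac:(lra)).
    unfold K; derive_solutions; [lra | field; lra].
  intros c hc; specialize (hKpos c ltac:(lra)); specialize (h12 c ltac:(lra)).
  apply Rmult_le_pos; [exact hKpos |].
  apply Rlt_le, Rinv_0_lt_compat, pow_lt; lra.
(* The ratio at x is smaller than its limit at -infinity; eps is small enough for the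
   asymptotics to exclude this far to the left. *)
set (delta := (b3 - b2) - r * (b2 - b1)).
assert (hdelta : 0 < delta).
  unfold delta.
  assert (h0 : 0 < Y b2 x - Y b1 x) by (specialize (h12 x hx); lra).
  apply (Rmult_lt_reg_r (Y b2 x - Y b1 x)); [exact h0 |].
  assert (r * (Y b2 x - Y b1 x) = Y b3 x - Y b2 x) by (unfold r; field; lra).
  nra.
set (eps := delta / (2 * (1 + r))).
assert (heps : 0 < eps) by (apply Rdiv_lt_0_compat; lra).
destruct (members_asymptotic b1 b2 ltac:(lra) ltac:(lra) eps heps) as [X1 hX1].
destruct (members_asymptotic b2 b3 ltac:(lra) ltac:(lra) eps heps) as [X2 hX2].
set (y := Rmin (Rmin X1 X2) x - 1).
assert (hy : y < X1 /\ y < X2 /\ y < x).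
  unfold y; pose proof (Rmin_l (Rmin X1 X2) x); pose proof (Rmin_r (Rmin X1 X2) x);
  pose proof (Rmin_l X1 X2); pose proof (Rmin_r X1 X2); lra.
specialize (hX1 y ltac:(lra)); specialize (hX2 y ltac:(lra)); specialize (hlow y ltac:(lra)).
apply Rabs_le_between in hX1; apply Rabs_le_between in hX2.
pose proof (proj1 (pf_gauge _ _ _ F) y) as hg.
assert (h1 : (b3 - b2 - eps) * g y <= r * (b2 - b1 + eps) * g y) by nra.
apply Rmult_le_reg_r in h1; [| exact hg].
assert (h2 : eps * (2 * (1 + r)) = delta) by (unfold eps; field; lra).
unfold delta in *; nra.
Qed.

(** Otherwise the poles of all larger parameters accumulate from the left at some
    tau <= x0, where y_b is still finite. By convexity the members with parameter
    close to b are bounded at two points tau - 2 d and tau - d, independently of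
    d; the mean value theorem yields a point xi between them with slope at most of order
    1/d. For small d the solution cannot grow from there to infinity
    before tau. *)
Lemma regular_right_neighbour (b x0 : R) :
  0 <= b -> regular sigma b x0 -> exists b3, b < b3 /\ x0 < sigma b3.
Proof.
intros hb hx0; apply NNPP; intros hno.
assert (hle : forall b3, b < b3 -> sigma b3 <= x0).
  intros b3 h3; apply Rnot_lt_le; intros h; apply hno; exists b3; auto.
destruct (completeness (fun t => exists b3, b < b3 /\ t = sigma b3)) as [tau [hub hlub]].
    exists x0; intros t [b3 [h3 ->]]; auto.
  exists (sigma (b + 1)), (b + 1); split; [lra | reflexivity].
assert (htau : tau <= x0) by (apply hlub; intros t [b3 [h3 ->]]; auto).
assert (hbelow : forall b3, b < b3 -> sigma b3 < tau).
  intros b3 h3.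
  apply Rlt_le_trans with (sigma ((b + b3) / 2)); [apply sigma_decreasing; lra |].
  apply hub; exists ((b + b3) / 2); split; [lra | reflexivity].
assert (habove : forall t, t < tau -> exists b3, b < b3 /\ t < sigma b3).
  intros t ht; apply NNPP; intros hn.
  assert (tau <= t); [| lra].
  apply hlub; intros y [b3 [h3 ->]].
  apply Rnot_lt_le; intros h; apply hn; exists b3; auto.
destruct (continuity_pt_near (Y b) tau 1) as [d0 [hd00 hd0]]; [| lra |].
  apply solves_continuity, regular_solves; [exact hb |].
  apply (regular_left b tau x0 htau hx0).
(* K bounds y_b near tau; u'' is at least -C0 for a positive solution u near tau, and at most
   CM while u <= M; the length d makes the growth of u between xi and tau too small for u
   to reach M. *)
set (K := Rabs (Y b tau) + 1).
pose proof (Rabs_pos (Y b tau)) as habs.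
set (M0 := Rabs tau + 2).
pose proof (Rabs_pos tau) as habst.
set (C0 := M0 ^ 2).
set (M := 5 * (K + 1) + C0 + 1).
set (CM := M0 * M + 2 * M ^ 3).
assert (hK : 1 <= K) by (unfold K; lra).
assert (hM0 : 2 <= M0) by (unfold M0; lra).
assert (hC0 : 0 <= C0) by (apply pow2_ge_0).
assert (hM : 0 < M) by (unfold M; lra).
assert (hCM : 0 <= CM).
  unfold CM; assert (0 < M ^ 3) by (apply pow_lt, hM); nra.
set (d := Rmin (Rmin (d0 / 3) (/ 4)) (/ (2 * CM + 2))).
assert (hd : 0 < d).
  unfold d; repeat apply Rmin_glb_lt; try lra; apply Rinv_0_lt_compat; lra.
assert (hdle : d <= d0 / 3 /\ d <= / 4 /\ d <= / (2 * CM + 2)).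
  unfold d; pose proof (Rmin_l (Rmin (d0 / 3) (/ 4)) (/ (2 * CM + 2)));
  pose proof (Rmin_r (Rmin (d0 / 3) (/ 4)) (/ (2 * CM + 2)));
  pose proof (Rmin_l (d0 / 3) (/ 4)); pose proof (Rmin_r (d0 / 3) (/ 4)); lra.
assert (hCMd : CM * (2 * d) ^ 2 / 2 < 1).
  assert (h1 : (2 * CM + 2) * d <= 1).
    replace 1 with ((2 * CM + 2) * / (2 * CM + 2)) by (field; lra).
    apply Rmult_le_compat_l; lra.
  assert (0 <= CM * d) by (apply Rmult_le_pos; lra).
  nra.
assert (hforce : forall t w, tau - 1 <= t <= tau -> 0 < w ->
    - C0 <= t * w + 2 * w ^ 3 /\ (w <= M -> t * w + 2 * w ^ 3 <= CM)).
  intros t w ht hw.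
  assert (ht' : - M0 <= t <= M0).
    unfold M0; pose proof (Rle_abs tau); pose proof (Rle_abs (- tau)) as h.
    rewrite Rabs_Ropp in h; lra.
  assert (hw3 : 0 < w ^ 3) by (apply pow_lt, hw).
  split.
    unfold C0; destruct (Rle_lt_dec w M0) as [h | h]; nra.
  intros hwM; unfold CM.
  assert (w ^ 3 <= M ^ 3) by (apply pow_incr; lra).
  nra.
destruct (habove (tau - d)) as [b3 [hb3 hb3s]]; [lra |].
pose proof (base_positive (tau - 2 * d)) as hp1.
pose proof (base_positive (tau - d)) as hp2.
assert (hreg3 : forall x, x <= tau - d -> Y 0 x <= Y b3 x).
  intros x hx; apply base_below; [lra | right; lra].
pose proof (hreg3 (tau - 2 * d) ltac:(lra)) as hq1.
pose proof (hreg3 (tau - d) ltac:(lra)) as hq2.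
set (Q := Y b3 (tau - 2 * d) + Y b3 (tau - d)).
assert (hQ : 0 < Q) by (unfold Q; lra).
set (b' := b + (b3 - b) / (Q + 2)).
assert (hb' : b < b' /\ (b' - b) * Q <= b3 - b' /\ b' < b3).
  assert (h : b' - b = (b3 - b) / (Q + 2)) by (unfold b'; ring).
  assert (h' : (b' - b) * (Q + 2) = b3 - b) by (rewrite h; field; lra).
  assert (0 < b' - b) by (rewrite h; apply Rdiv_lt_0_compat; lra).
  set (y := b' - b) in *.
  assert (b3 - b' = y * (Q + 2) - y) by (unfold y in *; lra).
  split; [unfold y in *; lra | split; nra].
destruct hb' as [hbb' [hb'Q hb'3]].
assert (hend : forall x, x = tau - 2 * d \/ x = tau - d -> Y b' x <= K + 1).
  intros x hx.
  assert (hxs : x < sigma b3) by (destruct hx as [-> | ->]; lra).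
  assert (hxt : tau - d0 < x < tau) by (destruct hx as [-> | ->]; lra).
  assert (hxQ : Y b3 x <= Q) by (unfold Q; destruct hx as [-> | ->]; lra).
  pose proof (convex_in_parameter b b' b3 x hb hbb' hb'3 hxs) as hcv.
  specialize (hd0 x); rewrite Rabs_left in hd0 by lra.
  specialize (hd0 ltac:(lra)); apply Rabs_def2 in hd0.
  pose proof (Rle_abs (Y b tau)).
  assert (hpx : 0 < Y b' x).
    apply Rlt_le_trans with (1 := base_positive x).
    apply base_below; [lra |].
    apply (regular_antitone b' b3); lra.
  assert (Y b' x - Y b x <= 1); [| unfold K; lra].
  apply (Rmult_le_reg_l (b3 - b')); [lra |].
  apply Rle_trans with (1 := hcv).
  apply Rle_trans with ((b' - b) * Q); [| lra].
  apply Rmult_le_compat_l; lra.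
pose proof (hbelow b' hbb') as hb't.
assert (hb's : tau - d < sigma b').
  assert (sigma b3 < sigma b') by (apply sigma_decreasing; lra); lra.
assert (hsol : forall t, t < sigma b' -> solves_at (Y b') t).
  intros t ht; apply (pf_solves _ _ _ F); lra.
assert (hpos : forall t, t < sigma b' -> 0 < Y b' t).
  intros t ht; apply Rlt_le_trans with (1 := base_positive t).
  apply base_below; [lra | right; exact ht].
destruct (mean_value (Y b') (Derive (Y b')) (tau - 2 * d) (tau - d)) as [xi [hxi hslope]].
- lra.
- intros t ht; apply solves_is_derive, hsol; lra.
- pose proof (hend (tau - 2 * d) (or_introl eq_refl)) as he1.
  pose proof (hend (tau - d) (or_intror eq_refl)) as he2.
  pose proof (hpos (tau - 2 * d) ltac:(lra)) as hp1'.
  pose proof (hpos (tau - d) ltac:(lra)) as hp2'.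
  replace (tau - d - (tau - 2 * d)) with d in hslope by ring.
  assert (hsl : forall y, 0 <= y <= 2 * d -> Rabs (Derive (Y b') xi) * y <= 2 * (K + 1)).
    intros y hy.
    apply Rle_trans with (Rabs (Derive (Y b') xi) * (2 * d)).
      apply Rmult_le_compat_l; [apply Rabs_pos | lra].
    replace (Rabs (Derive (Y b') xi) * (2 * d)) with (2 * (Rabs (Derive (Y b') xi) * Rabs d))
      by (rewrite (Rabs_pos_eq d); lra).
    rewrite <- Rabs_mult, <- hslope.
    assert (Rabs (Y b' (tau - d) - Y b' (tau - 2 * d)) <= K + 1) by (apply Rabs_le; lra).
    lra.
  pose proof (Rle_abs (Derive (Y b') xi)) as hsa.
  pose proof (Rle_abs (- Derive (Y b') xi)) as hsb; rewrite Rabs_Ropp in hsb.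
  assert (hstart : Y b' xi <= 3 * (K + 1) + C0).
    pose proof (taylor_lower_right (Y b') (Derive (Y b'))
      (fun t => t * Y b' t + 2 * Y b' t ^ 3) xi (tau - d) (- C0)) as h.
    assert (h' : Y b' xi + Derive (Y b') xi * (tau - d - xi) + - C0 * (tau - d - xi) ^ 2 / 2
      <= Y b' (tau - d)).
      apply h; [lra | | |]; intros t ht.
      - apply solves_is_derive, hsol; lra.
      - apply hsol; lra.
      - apply hforce; [lra | apply hpos; lra].
    specialize (hsl (tau - d - xi) ltac:(lra)).
    set (y := tau - d - xi) in *.
    assert (hy : 0 <= y <= 1) by (unfold y; lra).
    clearbody y.
    assert (hy2 : y ^ 2 <= 1) by nra.
    assert (hCy : C0 * y ^ 2 <= C0 * 1) by (apply Rmult_le_compat_l; assumption).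
    assert (- Derive (Y b') xi * y <= Rabs (Derive (Y b') xi) * y)
      by (apply Rmult_le_compat_r; lra).
    lra.
  assert (hbd : forall t, xi <= t < sigma b' -> Y b' t < M).
    intros t ht; apply Rnot_le_lt; intros hbig.
    destruct (first_zero (fun y => M - Y b' y) xi t) as [c [hc [hc0 hc1]]].
    - lra.
    - intros y hy; apply (continuity_pt_minus (fun _ => M) (Y b')).
        apply continuity_pt_const; intros y1 y2; reflexivity.
      apply solves_continuity, hsol; lra.
    - unfold M; lra.
    - lra.
    - pose proof (taylor_upper_right (Y b') (Derive (Y b'))
        (fun t => t * Y b' t + 2 * Y b' t ^ 3) xi c CM) as h.
      assert (h' : Y b' c <= Y b' xi + Derive (Y b') xi * (c - xi) + CM * (c - xi) ^ 2 / 2).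
        apply h; [lra | | |]; intros y hy.
        - apply solves_is_derive, hsol; lra.
        - apply hsol; lra.
        - apply hforce; [lra | apply hpos; lra |].
          destruct (Rlt_le_dec y c) as [hyc | hyc]; [specialize (hc1 y ltac:(lra)); lra |].
          replace y with c by lra; lra.
      specialize (hsl (c - xi) ltac:(lra)).
      set (y := c - xi) in *.
      assert (hy : 0 <= y <= 2 * d) by (unfold y; lra).
      clearbody y.
      assert (Derive (Y b') xi * y <= Rabs (Derive (Y b') xi) * y)
        by (apply Rmult_le_compat_r; lra).
      assert (CM * y ^ 2 <= CM * (2 * d) ^ 2).
        apply Rmult_le_compat_l; [exact hCM | apply pow_incr; lra].
      unfold M in *; lra.
  destruct (blow_up b' M xi) as [t [ht1 ht2]]; [lra | lra |].
  specialize (hbd t ltac:(lra)); lra.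
Qed.

(** By convexity y_b(s - 1) grows at least linearly in b, while the a priori
    bound holds for all members that exist up to s. *)
Lemma sigma_unbounded_below (s : R) : exists b, 0 < b /\ sigma b <= s.
Proof.
apply NNPP; intros hno.
assert (hs : forall b, 0 < b -> s < sigma b).
  intros b hb; apply Rnot_le_lt; intros h; apply hno; exists b; auto.
set (k := Rabs s + 2).
assert (hk : forall b, 0 < b -> Y b (s - 1) <= 3 + k).
  intros b hb.
  pose proof (Rabs_pos s); pose proof (Rle_abs (- s)) as h; rewrite Rabs_Ropp in h.
  replace 3 with (3 / 1) by field.
  apply keller_osserman; [lra | unfold k; lra | |].
    assert (1 - (s - 1) <= k) by (unfold k; lra).
    assert (1 <= k) by (unfold k; lra).
    nra.
  intros x hx; apply (pf_solves _ _ _ F); [exact hb |].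
  specialize (hs b hb); lra.
assert (h1 : 0 < Y 1 (s - 1) - Y 0 (s - 1)).
  specialize (hs 1 Rlt_0_1).
  pose proof (ordered 0 1 (s - 1)); lra.
set (w := Y 1 (s - 1) - Y 0 (s - 1)) in *.
assert (hk0 : 0 < k) by (unfold k; pose proof (Rabs_pos s); lra).
set (b := 1 + (4 + k) / w).
assert (hb : 0 < (4 + k) / w) by (apply Rdiv_lt_0_compat; lra).
pose proof (convex_in_parameter 0 1 b (s - 1)) as h.
specialize (hs b ltac:(unfold b; lra)).
specialize (h ltac:(lra) ltac:(lra) ltac:(unfold b; lra) ltac:(lra)).
specialize (hk b ltac:(unfold b; lra)).
fold w in h; replace ((b - 1) * w) with (4 + k) in h by (unfold b; field; lra).
pose proof (base_positive (s - 1)).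
unfold w in h1; lra.
Qed.

(** Let b be the infimum of the parameters whose pole is at most s. By
    [regular_right_neighbour], sigma b > s is impossible. If sigma b < s, the
    members with smaller parameter exist up to s and are uniformly bounded
    just before sigma b; letting the parameter increase to b, convexity transfers
    the bound to y_b, which blows up. *)
Lemma sigma_surjective (s : R) : exists b, 0 < b /\ sigma b = s.
Proof.
destruct (sigma_unbounded_below s) as [b1 [hb1 hb1s]].
(* The infimum of the parameters with sigma b <= s, as a supremum of opposites. *)
destruct (completeness (fun t => 0 < - t /\ sigma (- t) <= s)) as [m [hub hlub]].
    exists 0; intros t ht; lra.
  exists (- b1); rewrite Ropp_involutive; auto.
set (b := - m).
assert (hinf : forall b', 0 < b' -> sigma b' <= s -> b <= b').
  intros b' h1 h2.
  assert (- b' <= m); [| unfold b; lra].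
  apply hub; rewrite Ropp_involutive; auto.
assert (hinf' : forall b', b < b' -> exists b2, 0 < b2 < b' /\ sigma b2 <= s).
  intros b' hb'; apply NNPP; intros hn.
  assert (m <= - b'); [| unfold b in hb'; lra].
  apply hlub; intros t [ht1 ht2].
  apply Rnot_lt_le; intros h; apply hn; exists (- t); split; [lra | exact ht2].
assert (hb0 : 0 <= b).
  apply Rnot_lt_le; intros h; destruct (hinf' 0 h) as [b2 [h2 _]]; lra.
(* A pole of y_b beyond s would give poles beyond s for some larger parameter b3, although
   some parameter below b3 has its pole at most at s. *)
assert (hright : regular sigma b s -> False).
  intros hreg.
  destruct (regular_right_neighbour b s hb0 hreg) as [b3 [hb3 hb3s]].
  destruct (hinf' b3 hb3) as [b2 [h2 h2s]].
  assert (sigma b3 < sigma b2) by (apply sigma_decreasing; lra); lra.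
assert (hbpos : 0 < b).
  destruct hb0 as [h | h]; [exact h | exfalso; apply hright; left; lra].
exists b; split; [exact hbpos |].
destruct (Rtotal_order (sigma b) s) as [hlt | [h | h]]; [| exact h |];
  [| exfalso; apply hright; right; exact h].
exfalso.
set (X := sigma b) in *.
set (L := s - X).
set (k := L + Rabs X + 2).
pose proof (Rabs_pos X) as hX0; pose proof (Rle_abs (- X)) as hX1; rewrite Rabs_Ropp in hX1.
assert (hL : 0 < L) by (unfold L; lra).
assert (hbound : forall b' c, 0 < b' < b -> X - 1 < c < X -> Y b' c <= 3 / L + k).
  intros b' c hb' hc.
  apply keller_osserman; [exact hL | unfold k; lra | |].
    assert (L - c <= k) by (unfold k; lra).
    assert (1 <= k) by (unfold k; lra).
    nra.
  intros x hx; apply (pf_solves _ _ _ F); [lra |].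
  apply Rle_lt_trans with s; [unfold L in hx; lra |].
  apply Rnot_le_lt; intros h; specialize (hinf b' ltac:(lra) h); lra.
destruct (blow_up b (3 / L + k + 1) (X - 1)) as [c [hc hcM]]; [exact hbpos | fold X; lra |].
fold X in hc.
destruct (regular_right_neighbour b c hb0) as [b3 [hb3 hb3c]]; [right; fold X; lra |].
set (Q := Y b3 c - Y b c).
assert (hQ : 0 < Q) by (unfold Q; pose proof (ordered b b3 c); lra).
set (e := Rmin (b / 2) ((b3 - b) / Q)).
assert (he : 0 < e /\ e < b /\ e * Q <= b3 - b).
  assert (h : e <= b / 2) by apply Rmin_l.
  assert (h' : e <= (b3 - b) / Q) by apply Rmin_r.
  split; [| split; [lra |]].
    apply Rmin_glb_lt; [lra | apply Rdiv_lt_0_compat; lra].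
  replace (b3 - b) with ((b3 - b) / Q * Q) by (field; lra).
  apply Rmult_le_compat_r; lra.
pose proof (convex_in_parameter (b - e) b b3 c) as hcv.
specialize (hcv ltac:(lra) ltac:(lra) hb3 hb3c).
fold Q in hcv; replace (b - (b - e)) with e in hcv by ring.
specialize (hbound (b - e) c ltac:(lra) hc).
assert (1 < Y b c - Y (b - e) c) by lra.
nra.
Qed.

End Family.

(** * Laurent expansions on the real axis *)

Lemma pow_n_RtoC (t : R) (n : nat) : pow_n (K := C_Ring) (RtoC t) n = RtoC (t ^ n).
Proof.
induction n as [| n IH]; [reflexivity |].
simpl pow_n; rewrite IH; simpl pow; rewrite RtoC_mult; reflexivity.
Qed.

Lemma sum_n_Re_Im (c : nat -> C) (n : nat) :
  Re (sum_n (G := C_AbelianMonoid) c n) = sum_n (fun k => Re (c k)) n /\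
  Im (sum_n (G := C_AbelianMonoid) c n) = sum_n (fun k => Im (c k)) n.
Proof.
induction n as [| n [h1 h2]].
  rewrite !sum_O; auto.
rewrite !sum_Sn, <- h1, <- h2; auto.
Qed.

Lemma is_pseries_parts (a : nat -> C) (t : R) (l : C) :
  is_pseries (K := C_AbsRing) (V := C_NormedModule) a (RtoC t) l ->
  is_pseries (fun n => Re (a n)) t (Re l) /\ is_pseries (fun n => Im (a n)) t (Im l).
Proof.
intros h; unfold is_pseries, is_series in *.
split.
- apply (filterlim_ext (fun n => Re (sum_n (G := C_AbelianMonoid)
    (fun k => scal (V := C_ModuleSpace) (pow_n (K := C_Ring) (RtoC t) k) (a k)) n))).
    intros n; rewrite (proj1 (sum_n_Re_Im _ n)); apply sum_n_ext; intros k.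
    rewrite pow_n_RtoC.
    change (Re (RtoC (t ^ k) * a k)%C = pow_n (K := R_Ring) t k * Re (a k)).
    replace (pow_n (K := R_Ring) t k) with (t ^ k) by (symmetry; apply pow_n_pow).
    destruct (a k) as [p q]; simpl; ring.
  apply (filterlim_comp _ _ _ _ Re eventually (locally (T := C_UniformSpace) l) (locally (Re l))).
    exact h.
  apply (continuous_fst (U := R_UniformSpace) (V := R_UniformSpace)).
- apply (filterlim_ext (fun n => Im (sum_n (G := C_AbelianMonoid)
    (fun k => scal (V := C_ModuleSpace) (pow_n (K := C_Ring) (RtoC t) k) (a k)) n))).
    intros n; rewrite (proj2 (sum_n_Re_Im _ n)); apply sum_n_ext; intros k.
    rewrite pow_n_RtoC.
    change (Im (RtoC (t ^ k) * a k)%C = pow_n (K := R_Ring) t k * Im (a k)).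
    replace (pow_n (K := R_Ring) t k) with (t ^ k) by (symmetry; apply pow_n_pow).
    destruct (a k) as [p q]; simpl; ring.
  apply (filterlim_comp _ _ _ _ Im eventually (locally (T := C_UniformSpace) l) (locally (Im l))).
    exact h.
  apply (continuous_snd (U := R_UniformSpace) (V := R_UniformSpace)).
Qed.

Lemma CV_radius_of_convergence (a : nat -> R) (r : R) :
  (forall x, 0 < Rabs x < r -> ex_pseries a x) ->
  forall x, Rabs x < r -> Rbar_lt (Rabs x) (CV_radius a).
Proof.
intros h x hx.
pose proof (Rabs_pos x) as h0.
set (y := (Rabs x + r) / 2).
assert (hy : 0 < y) by (unfold y; lra).
apply Rbar_lt_le_trans with (Finite y); [simpl; unfold y; lra |].
apply Rbar_not_lt_le; intros hlt.
apply (CV_disk_outside a y).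
  rewrite Rabs_pos_eq by lra; exact hlt.
destruct (h y) as [l hl].
  rewrite Rabs_pos_eq by lra; unfold y; lra.
apply ex_series_lim_0.
exists l; apply (is_series_ext _ _ _ (fun n => eq_sym (Rmult_comm _ _))).
apply is_pseries_R in hl.
exact (is_series_ext _ _ _ (fun n => Rmult_comm _ _) hl).
Qed.

Lemma laurent_on_axis (f : C -> C) (x0 : R) (m : nat) (a : nat -> C) :
  laurent_at f (RtoC x0) m a ->
  exists r, 0 < r /\
    (forall t, Rabs t < r -> Rbar_lt (Rabs t) (CV_radius (fun n => Re (a n))) /\
      Rbar_lt (Rabs t) (CV_radius (fun n => Im (a n)))) /\
    forall t, 0 < Rabs t < r ->
      t ^ m * Re (f (RtoC (x0 + t))) = PSeries (fun n => Re (a n)) t /\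
      t ^ m * Im (f (RtoC (x0 + t))) = PSeries (fun n => Im (a n)) t.
Proof.
intros [r [hr h]].
assert (hs : forall t, 0 < Rabs t < r ->
    is_pseries (fun n => Re (a n)) t (t ^ m * Re (f (RtoC (x0 + t)))) /\
    is_pseries (fun n => Im (a n)) t (t ^ m * Im (f (RtoC (x0 + t))))).
  intros t ht.
  assert (e : (RtoC (x0 + t) - RtoC x0)%C = RtoC t).
    rewrite <- RtoC_minus; f_equal; ring.
  specialize (h (RtoC (x0 + t))); rewrite e in h.
  assert (hp : is_pseries (K := C_AbsRing) (V := C_NormedModule) a (RtoC t)
      (RtoC (t ^ m) * f (RtoC (x0 + t)))%C).
    rewrite RtoC_pow; apply h.
      intros e2; apply RtoC_inj in e2.
      replace t with 0 in ht by lra; rewrite Rabs_R0 in ht; lra.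
    rewrite Cmod_R; lra.
  apply is_pseries_parts in hp.
  replace (t ^ m * Re (f (RtoC (x0 + t)))) with (Re (RtoC (t ^ m) * f (RtoC (x0 + t)))%C)
    by (destruct (f (RtoC (x0 + t))); simpl; ring).
  replace (t ^ m * Im (f (RtoC (x0 + t)))) with (Im (RtoC (t ^ m) * f (RtoC (x0 + t)))%C)
    by (destruct (f (RtoC (x0 + t))); simpl; ring).
  exact hp.
exists r; split; [exact hr |]; split.
- intros t ht; split; apply (CV_radius_of_convergence _ r); try exact ht;
    intros x hx; eexists; apply (hs x hx).
- intros t ht; destruct (hs t ht) as [h1 h2].
  split; symmetry; apply is_pseries_unique; assumption.
Qed.

(** The product with (x - x0)^m tends to the nonzero leading coefficient, but
    would tend to 0 if f were bounded on the axis near x0. *)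
Lemma pole_unbounded (f : C -> C) (x0 : R) (m : nat) (r B : R) :
  pole_of_order f (RtoC x0) m -> 0 < r ->
  ~ (forall x, 0 < Rabs (x - x0) < r -> Rabs (Re (f (RtoC x))) <= B /\ Rabs (Im (f (RtoC x))) <= B).
Proof.
intros [hm [a [ha hl]]] hr hB.
destruct (laurent_on_axis f x0 m a hl) as [r1 [hr1 [hcv hser]]].
assert (key : forall (c : nat -> R) (w : R -> R),
    (forall t, Rabs t < r1 -> Rbar_lt (Rabs t) (CV_radius c)) ->
    (forall t, 0 < Rabs t < r1 -> t ^ m * w t = PSeries c t) ->
    (forall t, 0 < Rabs t < r -> Rabs (w t) <= B) -> c 0%nat = 0).
  intros c w h1 h2 h3; apply NNPP; intros hc.
  assert (hc0 : 0 < Rabs (c 0%nat)) by (apply Rabs_pos_lt, hc).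
  destruct (continuity_pt_near (PSeries c) 0 (Rabs (c 0%nat) / 2)) as [d [hd0 hd]]; [| lra |].
    apply PSeries_continuity, h1; rewrite Rabs_R0; exact hr1.
  assert (hBp : 0 <= Rabs B) by apply Rabs_pos.
  set (e := Rabs (c 0%nat) / (2 * (Rabs B + 1))).
  assert (he : 0 < e) by (apply Rdiv_lt_0_compat; lra).
  set (t := Rmin (Rmin d e) (Rmin (Rmin r r1) 1) / 2).
  pose proof (Rmin_l (Rmin d e) (Rmin (Rmin r r1) 1));
  pose proof (Rmin_r (Rmin d e) (Rmin (Rmin r r1) 1));
  pose proof (Rmin_l (Rmin r r1) 1); pose proof (Rmin_r (Rmin r r1) 1);
  pose proof (Rmin_l r r1); pose proof (Rmin_r r r1);
  pose proof (Rmin_l d e); pose proof (Rmin_r d e).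
  assert (ht0 : 0 < Rmin (Rmin d e) (Rmin (Rmin r r1) 1)) by (repeat apply Rmin_glb_lt; lra).
  assert (ht : 0 < t /\ t < d /\ t < e /\ t < r /\ t < r1 /\ t < 1) by (unfold t; lra).
  clearbody t.
  assert (hta : Rabs t = t) by (apply Rabs_pos_eq; lra).
  specialize (hd t); rewrite Rminus_0_r, hta, PSeries_0 in hd; specialize (hd ltac:(lra)).
  rewrite <- h2 in hd by (rewrite hta; lra).
  specialize (h3 t ltac:(rewrite hta; lra)).
  assert (hpow : 0 <= t ^ m <= t).
    destruct m as [| n]; [lia |].
    assert (h : 0 <= t ^ n <= 1).
      split; [apply pow_le; lra |].
      rewrite <- (pow1 n); apply pow_incr; lra.
    simpl; nra.
  assert (h4 : Rabs (t ^ m * w t) <= t * Rabs B).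
    rewrite Rabs_mult, (Rabs_pos_eq (t ^ m)) by lra.
    pose proof (Rle_abs B).
    apply Rmult_le_compat; try lra; apply Rabs_pos.
  assert (h5 : t * Rabs B <= Rabs (c 0%nat) / 2).
    assert (e * (Rabs B + 1) = Rabs (c 0%nat) / 2) by (unfold e; field; lra).
    nra.
  pose proof (Rabs_triang_inv (c 0%nat) (t ^ m * w t)) as h6.
  rewrite (Rabs_minus_sym (c 0%nat)) in h6; lra.
apply ha.
assert (hB' : forall t, 0 < Rabs t < r ->
    Rabs (Re (f (RtoC (x0 + t)))) <= B /\ Rabs (Im (f (RtoC (x0 + t)))) <= B).
  intros t ht; apply hB; replace (x0 + t - x0) with t by ring; exact ht.
apply injective_projections; simpl.
- apply (key (fun n => Re (a n)) (fun t => Re (f (RtoC (x0 + t))))).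
  + intros t ht; apply (hcv t ht).
  + intros t ht; apply (hser t ht).
  + intros t ht; apply (hB' t ht).
- apply (key (fun n => Im (a n)) (fun t => Im (f (RtoC (x0 + t))))).
  + intros t ht; apply (hcv t ht).
  + intros t ht; apply (hser t ht).
  + intros t ht; apply (hB' t ht).
Qed.

(** At nearby points the Laurent expansion is continuous, so f is bounded around
    them and they are not poles. *)
Lemma laurent_isolated (f : C -> C) (x0 : R) (m : nat) (a : nat -> C) :
  meromorphic f -> laurent_at f (RtoC x0) m a ->
  exists r, 0 < r /\ forall x, 0 < Rabs (x - x0) < r -> analytic_at f (RtoC x).
Proof.
intros hmero hl.
destruct (laurent_on_axis f x0 m a hl) as [r [hr [hcv hser]]].
exists r; split; [exact hr |].
intros x1 hx1.
destruct (hmero (RtoC x1)) as [h | [n hpole]]; [exact h | exfalso].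
set (t1 := x1 - x0) in *.
assert (ht1 : t1 <> 0) by (intros e; rewrite e, Rabs_R0 in hx1; lra).
assert (key : forall c : nat -> R,
    (forall t, Rabs t < r -> Rbar_lt (Rabs t) (CV_radius c)) ->
    continuity_pt (fun t => PSeries c t / t ^ m) t1).
  intros c hc.
  apply (continuity_pt_div (PSeries c) (fun t => t ^ m)).
  - apply PSeries_continuity, hc; lra.
  - apply derivable_continuous_pt, derivable_pt_pow.
  - apply pow_nonzero, ht1.
destruct (continuity_pt_near _ _ 1 (key (fun n => Re (a n)) (fun t ht => proj1 (hcv t ht))))
  as [d1 [hd10 hd1]]; [lra |].
destruct (continuity_pt_near _ _ 1 (key (fun n => Im (a n)) (fun t ht => proj2 (hcv t ht))))
  as [d2 [hd20 hd2]]; [lra |].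
set (B1 := Rabs (PSeries (fun n => Re (a n)) t1 / t1 ^ m)) in *.
set (B2 := Rabs (PSeries (fun n => Im (a n)) t1 / t1 ^ m)) in *.
pose proof (Rabs_pos t1).
set (e := Rmin (Rmin d1 d2) (Rmin (Rabs t1) (r - Rabs t1))).
assert (he : 0 < e) by (unfold e; repeat apply Rmin_glb_lt; lra).
assert (he1 : e <= d1 /\ e <= d2 /\ e <= Rabs t1 /\ e <= r - Rabs t1).
  unfold e; pose proof (Rmin_l (Rmin d1 d2) (Rmin (Rabs t1) (r - Rabs t1)));
  pose proof (Rmin_r (Rmin d1 d2) (Rmin (Rabs t1) (r - Rabs t1)));
  pose proof (Rmin_l d1 d2); pose proof (Rmin_r d1 d2);
  pose proof (Rmin_l (Rabs t1) (r - Rabs t1)); pose proof (Rmin_r (Rabs t1) (r - Rabs t1)); lra.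
apply (pole_unbounded f x1 n e (B1 + B2 + 1) hpole he).
intros x hx.
set (t := x - x0).
assert (ht : t - t1 = x - x1) by (unfold t, t1; ring).
assert (htr : 0 < Rabs t < r).
  pose proof (Rabs_triang t1 (t - t1)) as h1.
  replace (t1 + (t - t1)) with t in h1 by ring.
  pose proof (Rabs_triang_inv t1 (t1 - t)) as h2.
  replace (t1 - (t1 - t)) with t in h2 by ring.
  rewrite (Rabs_minus_sym t1 t) in h2.
  rewrite ht in h1, h2; lra.
assert (htm : t ^ m <> 0).
  apply pow_nonzero; intros e0; rewrite e0, Rabs_R0 in htr; lra.
destruct (hser t htr) as [h1 h2].
replace (x0 + t) with x in h1, h2 by (unfold t; ring).
specialize (hd1 t); specialize (hd2 t); cbv beta in hd1, hd2.
rewrite <- h1, ht in hd1; rewrite <- h2, ht in hd2.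
replace (t ^ m * Re (f (RtoC x)) / t ^ m) with (Re (f (RtoC x))) in hd1 by (field; exact htm).
replace (t ^ m * Im (f (RtoC x)) / t ^ m) with (Im (f (RtoC x))) in hd2 by (field; exact htm).
specialize (hd1 ltac:(lra)); specialize (hd2 ltac:(lra)).
pose proof (Rabs_triang_inv (Re (f (RtoC x))) (PSeries (fun n => Re (a n)) t1 / t1 ^ m)) as h3.
pose proof (Rabs_triang_inv (Im (f (RtoC x))) (PSeries (fun n => Im (a n)) t1 / t1 ^ m)) as h4.
fold B1 in h3; fold B2 in h4.
assert (0 <= B1 /\ 0 <= B2) by (split; apply Rabs_pos).
lra.
Qed.

Lemma analytic_neighbourhood (f : C -> C) (x0 : R) :
  meromorphic f -> analytic_at f (RtoC x0) ->
  exists r, 0 < r /\ forall x, Rabs (x - x0) < r -> analytic_at f (RtoC x).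
Proof.
intros hmero han.
pose proof han as [a [r [hr h]]].
destruct (laurent_isolated f x0 0 a hmero) as [r' [hr' h']].
  exists r; split; [exact hr |].
  intros w _ hw.
  replace ((w - RtoC x0) ^ 0 * f w)%C with (f w) by (simpl; ring).
  apply h, hw.
exists r'; split; [exact hr' |].
intros x hx.
destruct (Req_dec x x0) as [-> | hne]; [exact han |].
apply h'; split; [apply Rabs_pos_lt; lra | exact hx].
Qed.

Lemma is_derive_on_axis (f : C -> C) (x : R) (l : C) :
  is_derive (K := C_AbsRing) (V := C_NormedModule) f (RtoC x) l ->
  is_derive (fun t : R => Re (f (RtoC t))) x (Re l).
Proof.
intros [_ h].
apply is_derive_Reals; intros eps heps.
assert (heps2 : 0 < eps / 2) by lra.
specialize (h (RtoC x) (fun P hP => hP) (mkposreal _ heps2)).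
destruct h as [d hd].
exists d; intros t ht htd.
specialize (hd (RtoC (x + t))).
assert (e : minus (G := C_AbelianGroup) (RtoC (x + t)) (RtoC x) = RtoC t).
  change ((RtoC (x + t) - RtoC x)%C = RtoC t).
  rewrite <- RtoC_minus; f_equal; ring.
assert (hb : ball (M := AbsRing_UniformSpace C_AbsRing) (RtoC x) d (RtoC (x + t))).
  change (Cmod (minus (G := C_AbelianGroup) (RtoC (x + t)) (RtoC x)) < d).
  rewrite e, Cmod_R; exact htd.
specialize (hd hb).
change (Cmod ((f (RtoC (x + t)) - f (RtoC x)) -
  (minus (G := C_AbelianGroup) (RtoC (x + t)) (RtoC x)) * l)%C <=
  eps / 2 * Cmod (minus (G := C_AbelianGroup) (RtoC (x + t)) (RtoC x))) in hd.
rewrite e, Cmod_R in hd.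
apply (Rle_trans _ _ _ (re_le_Cmod _)) in hd.
assert (hta : 0 < Rabs t) by (apply Rabs_pos_lt, ht).
replace ((Re (f (RtoC (x + t))) - Re (f (RtoC x))) / t - Re l)
  with ((Re (f (RtoC (x + t))) - Re (f (RtoC x)) - t * Re l) / t) by (field; exact ht).
unfold Rdiv; rewrite Rabs_mult, Rabs_inv.
apply (Rmult_lt_reg_r (Rabs t)); [exact hta |].
rewrite Rmult_assoc, Rinv_l, Rmult_1_r by lra.
apply Rle_lt_trans with (eps / 2 * Rabs t).
  apply Rle_trans with (2 := hd).
  right; f_equal.
  destruct (f (RtoC (x + t))), (f (RtoC x)), l; simpl; ring.
nra.
Qed.

Lemma on_axis_solves (f : C -> C) (x : R) :
  painleve2_solution f -> real_on_axis f -> analytic_at f (RtoC x) ->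
  solves_at (on_axis f) x.
Proof.
intros [hmero hode] hreal hx.
assert (hder : forall t, analytic_at f (RtoC t) ->
    is_derive (on_axis f) t (Re (C_derive f (RtoC t)))).
  intros t ht.
  apply (is_derive_on_axis f t), C_derive_correct; [exact (RtoC 0) |].
  apply (hode _ ht).
split; [eexists; apply hder, hx |].
destruct (analytic_neighbourhood f x hmero hx) as [r [hr hnear]].
apply (is_derive_ext_loc (fun t : R => Re (C_derive f (RtoC t)))).
  exists (mkposreal r hr); intros t ht.
  symmetry; apply is_derive_unique, hder, hnear, ht.
destruct (hode _ hx) as [_ h].
apply is_derive_on_axis in h.
specialize (hreal x hx).
replace (x * on_axis f x + 2 * on_axis f x ^ 3)
  with (Re (RtoC x * f (RtoC x) + 2 * f (RtoC x) ^ 3)%C); [exact h |].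
unfold on_axis; destruct (f (RtoC x)) as [p q]; simpl in *; rewrite hreal; ring.
Qed.

(** * Poles of real solutions *)

Lemma CV_radius_PS_derive (c : nat -> R) (t : R) :
  Rbar_lt (Rabs t) (CV_radius c) -> Rbar_lt (Rabs t) (CV_radius (PS_derive c)).
Proof. rewrite CV_radius_derive; auto. Qed.

(** Put A = t^m u and B = t A' - m A = t^(m+1) u'. The equation becomes
    t^(2 m - 2) (t B' - (m + 1) B - t^2 x A) = 2 A^3 with A and B smooth at t = 0. At
    t = 0 this reads 0 = 2 c0^3 if m >= 2, and 2 c0 = 2 c0^3 if m = 1. For m = 1 the
    terms of first order give -2 c1 + 2 c1 = 6 c0^2 c1. *)
Lemma laurent_pole_order_one (u : R -> R) (x0 r : R) (m : nat) (c : nat -> R) :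
  0 < r -> (0 < m)%nat -> c 0%nat <> 0 ->
  (forall t, Rabs t < r -> Rbar_lt (Rabs t) (CV_radius c)) ->
  (forall t, 0 < t < r -> solves_at u (x0 + t)) ->
  (forall t, 0 < t < r -> t ^ m * u (x0 + t) = PSeries c t) ->
  m = 1%nat /\ c 0%nat ^ 2 = 1 /\ c 1%nat = 0.
Proof.
intros hr hm hc0 hcv hsol hser.
destruct m as [| n]; [lia |].
set (A := PSeries c).
set (A1 := PSeries (PS_derive c)).
set (A2 := PSeries (PS_derive (PS_derive c))).
assert (hA : forall t, Rabs t < r -> is_derive A t (A1 t)).
  intros t ht; apply is_derive_PSeries, hcv, ht.
assert (hA1 : forall t, Rabs t < r -> is_derive A1 t (A2 t)).
  intros t ht; apply is_derive_PSeries, CV_radius_PS_derive, hcv, ht.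
assert (hAc : continuity_pt A 0).
  eapply is_derive_continuity_pt, hA; rewrite Rabs_R0; exact hr.
assert (hA1c : continuity_pt A1 0).
  eapply is_derive_continuity_pt, hA1; rewrite Rabs_R0; exact hr.
assert (hA2c : continuity_pt A2 0).
  apply PSeries_continuity, CV_radius_PS_derive, CV_radius_PS_derive, hcv.
  rewrite Rabs_R0; exact hr.
assert (hnear : forall t, 0 < t < r -> locally t (fun y => 0 < y < r)).
  intros t ht; apply (locally_interval _ t 0 r); simpl; [lra | lra |].
  intros y h1 h2; simpl in *; lra.
set (m := INR (S n)).
(* The identities t A' - m A = t^(m+1) u' and its derivative. *)
assert (hB : forall t, 0 < t < r -> t * A1 t - m * A t = t ^ (S (S n)) * Derive u (x0 + t)).
  intros t ht.
  assert (h1 : is_derive A t (m * t ^ n * u (x0 + t) + t ^ (S n) * Derive u (x0 + t))).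
    apply (is_derive_ext_loc (fun s => s ^ (S n) * u (x0 + s))).
      apply (filter_imp _ _ hser), hnear, ht.
    specialize (hsol t ht).
    auto_derive; [exact (proj1 hsol) |].
    change (match n with 0%nat => 1 | S _ => INR n + 1 end) with m.
    set (du := Derive u (x0 + t)); simpl pow; ring.
  assert (h2 : A1 t = m * t ^ n * u (x0 + t) + t ^ (S n) * Derive u (x0 + t)).
    apply is_derive_unique in h1.
    rewrite <- h1; symmetry; apply is_derive_unique, hA.
    rewrite Rabs_pos_eq; lra.
  rewrite h2; unfold A; rewrite <- (hser t ht); simpl pow; ring.
assert (hB' : forall t, 0 < t < r ->
    t * (t * A2 t + A1 t - m * A1 t) = (m + 1) * (t * A1 t - m * A t)
      + t ^ (S (S n)) * t * ((x0 + t) * u (x0 + t) + 2 * u (x0 + t) ^ 3)).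
  intros t ht.
  assert (ht' : Rabs t < r) by (rewrite Rabs_pos_eq; lra).
  assert (h1 : is_derive (fun s => s * A1 s - m * A s) t
      ((m + 1) * t ^ (S n) * Derive u (x0 + t)
       + t ^ (S (S n)) * ((x0 + t) * u (x0 + t) + 2 * u (x0 + t) ^ 3))).
    apply (is_derive_ext_loc (fun s => s ^ (S (S n)) * Derive u (x0 + s))).
      apply (filter_imp _ _ (fun y hy => eq_sym (hB y hy))), hnear, ht.
    specialize (hsol t ht).
    auto_derive; [apply solves_ex_derive2, hsol |].
    rewrite (solves_Derive2 u (x0 + t) hsol).
    change (match n with 0%nat => 1 | S _ => INR n + 1 end) with m.
    simpl pow; ring.
  assert (h2 : is_derive (fun s => s * A1 s - m * A s) t (t * A2 t + A1 t - m * A1 t)).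
    pose proof (hA t ht') as ha; pose proof (hA1 t ht') as ha1.
    auto_derive.
      repeat split; eexists; eassumption.
    rewrite (is_derive_unique (fun s : R => A s) t _ ha), (is_derive_unique (fun s : R => A1 s) t _ ha1).
    ring.
  apply is_derive_unique in h1; apply is_derive_unique in h2.
  rewrite h1 in h2; rewrite <- h2, (hB t ht); simpl pow; ring.
(* Painleve II multiplied by t^(3 m), where m = n + 1. *)
assert (hode : forall t, 0 < t < r ->
    (t ^ n) ^ 2 * (t * (t * A2 t + A1 t - m * A1 t) - (m + 1) * (t * A1 t - m * A t)
      - t ^ 2 * (x0 + t) * A t) = 2 * A t ^ 3).
  intros t ht; rewrite (hB' t ht); unfold A; rewrite <- (hser t ht); simpl pow; ring.
assert (hA0 : A 0 = c 0%nat) by apply PSeries_0.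
assert (h0 : (0 ^ n) ^ 2 * (0 * (0 * A2 0 + A1 0 - m * A1 0) - (m + 1) * (0 * A1 0 - m * A 0)
      - 0 ^ 2 * (x0 + 0) * A 0) = 2 * A 0 ^ 3).
  apply (eq_at_puncture (fun t => (t ^ n) ^ 2 * (t * (t * A2 t + A1 t - m * A1 t)
    - (m + 1) * (t * A1 t - m * A t) - t ^ 2 * (x0 + t) * A t)) (fun t => 2 * A t ^ 3) r);
    [exact hr | polynomial_continuity | polynomial_continuity | exact hode].
destruct n as [| n].
- assert (hm1 : m = 1) by (unfold m; simpl; ring).
  rewrite hm1, hA0 in h0.
  assert (hsq : c 0%nat ^ 2 = 1).
    apply (Rmult_eq_reg_l (2 * c 0%nat)); [| lra].
    simpl in h0 |- *; lra.
  split; [reflexivity | split; [exact hsq |]].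
  (* With A = c0 + t S, the terms of order zero cancel and t can be divided out. *)
  set (S := PSeries (PS_decr_1 c)).
  assert (hS : forall t, Rabs t < r -> A t = c 0%nat + t * S t).
    intros t ht; unfold A, S; apply PSeries_decr_1, CV_radius_inside, hcv, ht.
  assert (hSc : continuity_pt S 0).
    apply PSeries_continuity; rewrite CV_radius_decr_1.
    apply hcv; rewrite Rabs_R0; exact hr.
  assert (h1 : 0 * A2 0 - 2 * A1 0 + 2 * S 0 - 0 * (x0 + 0) * A 0
      = 2 * S 0 * (A 0 ^ 2 + A 0 * c 0%nat + 1)).
    apply (eq_at_puncture (fun t => t * A2 t - 2 * A1 t + 2 * S t - t * (x0 + t) * A t)
      (fun t => 2 * S t * (A t ^ 2 + A t * c 0%nat + 1)) r);
      [exact hr | polynomial_continuity | polynomial_continuity |].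
    intros t ht; specialize (hode t ht); rewrite hm1 in hode.
    assert (ht' : Rabs t < r) by (rewrite Rabs_pos_eq; lra).
    specialize (hS t ht').
    apply (Rmult_eq_reg_l t); [| lra].
    revert hode hS hsq.
    generalize (A t) (A1 t) (A2 t) (S t) (c 0%nat); intros a a1 a2 s e hode hS hsq.
    assert (h2 : t * s = a - e) by lra.
    replace (t * (2 * s * (a ^ 2 + a * e + 1))) with (2 * (t * s) * (a ^ 2 + a * e + 1)) by ring.
    replace (t * (t * a2 - 2 * a1 + 2 * s - t * (x0 + t) * a))
      with (t ^ 2 * a2 - 2 * t * a1 + 2 * (t * s) - t ^ 2 * (x0 + t) * a) by ring.
    rewrite h2.
    replace (2 * (a - e) * (a ^ 2 + a * e + 1))
      with (2 * a ^ 3 - 2 * e + 2 * a * (1 - e ^ 2)) by ring.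
    rewrite hsq; simpl in hode |- *; lra.
  assert (hS0 : S 0 = c 1%nat) by apply PSeries_0.
  assert (hA10 : A1 0 = c 1%nat).
    unfold A1; rewrite PSeries_0; unfold PS_derive; simpl; ring.
  rewrite hA0, hS0, hA10 in h1.
  replace (c 0%nat ^ 2 + c 0%nat * c 0%nat + 1) with (2 * c 0%nat ^ 2 + 1) in h1 by ring.
  rewrite hsq in h1; lra.
- exfalso; apply hc0.
  rewrite hA0 in h0.
  replace (0 ^ S n) with 0 in h0 by (simpl; ring).
  assert (h1 : c 0%nat ^ 3 = 0) by lra.
  apply NNPP; intros h; apply (pow_nonzero _ 3 h), h1.
Qed.

(** The leading coefficient is real because f is real at the neighbouring points
    of the axis, which are not poles. *)
Lemma real_pole (f : C -> C) (x0 : R) :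
  painleve2_solution f -> real_on_axis f -> ~ analytic_at f (RtoC x0) ->
  exists (a : nat -> C) (e : R), e ^ 2 = 1 /\ a 0%nat = RtoC e /\
    laurent_at f (RtoC x0) 1 a /\
    forall eps, 0 < eps -> exists d, 0 < d /\
      forall x, 0 < Rabs (x - x0) < d -> Rabs (on_axis f x - e / (x - x0)) < eps.
Proof.
intros hsol hreal hna.
assert (hmero := proj1 hsol).
destruct (hmero (RtoC x0)) as [h | [m [hm [a [ha hl]]]]]; [contradiction |].
destruct (laurent_on_axis f x0 m a hl) as [r1 [hr1 [hcv1 hser1]]].
destruct (laurent_isolated f x0 m a hmero hl) as [r2 [hr2 han]].
set (r := Rmin r1 r2).
assert (hr : 0 < r) by (apply Rmin_glb_lt; assumption).
assert (hrr : r <= r1 /\ r <= r2) by (split; [apply Rmin_l | apply Rmin_r]).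
assert (han' : forall t, 0 < Rabs t < r -> analytic_at f (RtoC (x0 + t))).
  intros t ht; apply han; replace (x0 + t - x0) with t by ring; lra.
set (c := fun n => Re (a n)).
assert (him : Im (a 0%nat) = 0).
  rewrite <- (PSeries_0 (fun n => Im (a n))).
  apply (eq_at_puncture _ (fun _ => 0) r).
  - exact hr.
  - apply PSeries_continuity, hcv1; rewrite Rabs_R0; exact hr1.
  - apply continuity_pt_const; intros y1 y2; reflexivity.
  - intros t ht.
    assert (hta : Rabs t = t) by (apply Rabs_pos_eq; lra).
    rewrite <- (proj2 (hser1 t ltac:(rewrite hta; lra))).
    rewrite hreal; [ring | apply han'; rewrite hta; lra].
assert (hc0 : c 0%nat <> 0).
  intros h; apply ha.
  apply injective_projections; simpl; [exact h | exact him].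
destruct (laurent_pole_order_one (on_axis f) x0 r m c) as [hm1 [hsq hc1]].
- exact hr.
- exact hm.
- exact hc0.
- intros t ht; apply hcv1; lra.
- intros t ht; apply on_axis_solves; [assumption | assumption |].
  apply han'; rewrite Rabs_pos_eq; lra.
- intros t ht; apply hser1; rewrite Rabs_pos_eq; lra.
- exists a, (c 0%nat).
  split; [exact hsq |]; split.
    apply injective_projections; simpl; [reflexivity | exact him].
  subst m; split; [exact hl |].
  intros eps heps.
  set (S := PSeries (PS_decr_1 c)).
  assert (hS0 : S 0 = 0) by (unfold S; rewrite PSeries_0; exact hc1).
  destruct (continuity_pt_near S 0 eps) as [d [hd0 hd]].
  + apply PSeries_continuity; rewrite CV_radius_decr_1.
    apply hcv1; rewrite Rabs_R0; exact hr1.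
  + exact heps.
  + exists (Rmin d r); split; [apply Rmin_glb_lt; assumption |].
    intros x hx.
    pose proof (Rmin_l d r); pose proof (Rmin_r d r).
    set (t := x - x0) in *.
    specialize (hd t); rewrite Rminus_0_r, hS0, Rminus_0_r in hd.
    specialize (hd ltac:(lra)).
    destruct (hser1 t ltac:(lra)) as [h1 _].
    fold c in h1.
    rewrite (PSeries_decr_1 c t) in h1 by (apply CV_radius_inside, hcv1; lra).
    fold S in h1; rewrite pow_1 in h1.
    replace (x0 + t) with x in h1 by (unfold t; ring).
    assert (htn : t <> 0) by (intros e0; rewrite e0, Rabs_R0 in hx; lra).
    replace (on_axis f x - c 0%nat / t) with (S t); [exact hd |].
    unfold on_axis; apply (Rmult_eq_reg_l t); [| exact htn].
    rewrite Rmult_minus_distr_l, h1; field; exact htn.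
Qed.

(** The infimum of the non-analytic points of the axis, which is itself such a
    point because analyticity on the axis is an open condition. *)
Lemma first_singularity (f : C -> C) (X : R) :
  meromorphic f -> (forall x : R, x < X -> analytic_at f (RtoC x)) ->
  ~ (forall x : R, analytic_at f (RtoC x)) ->
  exists s : R, ~ analytic_at f (RtoC s) /\ forall x, x < s -> analytic_at f (RtoC x).
Proof.
intros hmero hX hne.
destruct (completeness (fun t => ~ analytic_at f (RtoC (- t)))) as [m [hub hlub]].
- exists (- X); intros t ht.
  apply Rnot_lt_le; intros h; apply ht, hX; lra.
- apply NNPP; intros hn; apply hne; intros x; apply NNPP; intros hx.
  apply hn; exists (- x); rewrite Ropp_involutive; exact hx.
- exists (- m).
  assert (hbelow : forall x, x < - m -> analytic_at f (RtoC x)).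
    intros x hx; apply NNPP; intros hn.
    assert (- x <= m); [| lra].
    apply hub; rewrite Ropp_involutive; exact hn.
  split; [| exact hbelow].
  intros han.
  destruct (analytic_neighbourhood f (- m) hmero han) as [r [hr h]].
  assert (m <= m - r); [| lra].
  apply hlub; intros t ht.
  apply Rnot_lt_le; intros htr; apply ht.
  destruct (Rlt_le_dec (- t) (- m)) as [h1 | h1]; [apply hbelow, h1 |].
  apply h; rewrite Rabs_pos_eq; lra.
Qed.

(** * The Hastings-McLeod family *)

Definition hm_gauge (x : R) : R :=
  / Rpower (- x) (1 / 4) * exp (- (2 * sqrt 2 / 3) * Rpower (- x) (3 / 2)).

Lemma hm_gauge_spec : gauge hm_gauge.
Proof.
split.
  intros x; apply Rmult_lt_0_compat; [apply Rinv_0_lt_compat |]; apply exp_pos.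
intros eps heps.
exists (Rmin (-1) (- Rpower (/ eps + 1) 4)); intros x hx.
pose proof (Rmin_l (-1) (- Rpower (/ eps + 1) 4));
pose proof (Rmin_r (-1) (- Rpower (/ eps + 1) 4)).
assert (hi : 0 < / eps) by (apply Rinv_0_lt_compat, heps).
assert (h1 : / eps + 1 <= Rpower (- x) (1 / 4)).
  replace (/ eps + 1) with (Rpower (Rpower (/ eps + 1) 4) (1 / 4)).
    apply Rle_Rpower_l; [lra |].
    split; [apply exp_pos | lra].
  rewrite Rpower_mult; replace (4 * (1 / 4)) with 1 by field.
  apply Rpower_1; lra.
assert (h2 : exp (- (2 * sqrt 2 / 3) * Rpower (- x) (3 / 2)) <= 1).
  rewrite <- exp_0; left; apply exp_increasing.
  assert (0 < sqrt 2) by (apply sqrt_lt_R0; lra).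
  assert (0 < Rpower (- x) (3 / 2)) by apply exp_pos.
  nra.
unfold hm_gauge.
assert (h3 : / Rpower (- x) (1 / 4) <= / (/ eps + 1)) by (apply Rinv_le_contravar; lra).
assert (h4 : 0 < / Rpower (- x) (1 / 4)) by (apply Rinv_0_lt_compat, exp_pos).
assert (h5 : / (/ eps + 1) < eps).
  rewrite <- (Rinv_inv eps) at 2; apply Rinv_lt_contravar; nra.
pose proof (exp_pos (- (2 * sqrt 2 / 3) * Rpower (- x) (3 / 2))).
nra.
Qed.

Lemma hm_perturbation_asymptotic (f0 f : C -> C) (b : R) :
  hm_perturbation f0 b f ->
  asymptotic_to hm_gauge b (fun x => on_axis f x - on_axis f0 x).
Proof.
intros [_ [_ h]] eps heps.
pose proof (Rabs_pos b) as hb.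
assert (he : 0 < eps / (Rabs b + 1)) by (apply Rdiv_lt_0_compat; lra).
destruct (h (mkposreal _ he)) as [X hX].
exists X; intros x hx; specialize (hX x hx).
change (Rabs (b / Rpower (- x) (1 / 4) * exp (- (2 * sqrt 2 / 3) * Rpower (- x) (3 / 2))
   - (on_axis f x - on_axis f0 x)) <= eps / (Rabs b + 1) *
   Rabs (b / Rpower (- x) (1 / 4) * exp (- (2 * sqrt 2 / 3) * Rpower (- x) (3 / 2)))) in hX.
replace (b / Rpower (- x) (1 / 4) * exp (- (2 * sqrt 2 / 3) * Rpower (- x) (3 / 2)))
  with (b * hm_gauge x) in hX by (unfold hm_gauge, Rdiv; ring).
rewrite Rabs_minus_sym in hX; apply Rle_trans with (1 := hX).
pose proof (proj1 hm_gauge_spec x) as hg.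
rewrite Rabs_mult, (Rabs_pos_eq (hm_gauge x)), <- Rmult_assoc by lra.
apply Rmult_le_compat_r; [lra |].
apply (Rmult_le_reg_r (Rabs b + 1)); [lra |].
replace (eps / (Rabs b + 1) * Rabs b * (Rabs b + 1)) with (eps * Rabs b) by (field; lra).
nra.
Qed.

Lemma hastings_mcleod_separating (f : C -> C) :
  hastings_mcleod f -> separating (on_axis f).
Proof.
intros [hsol [hreal [han [hleft _]]]].
split.
  intros x; apply on_axis_solves; auto.
destruct (hleft (mkposreal (/ 10) ltac:(lra))) as [X hX].
exists (Rmin X 0); intros x hx.
pose proof (Rmin_l X 0); pose proof (Rmin_r X 0).
specialize (hX x ltac:(lra)).
change (Rabs (sqrt (- x / 2) - on_axis f x) <= / 10 * Rabs (sqrt (- x / 2))) in hX.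
assert (hs : 0 < sqrt (- x / 2)) by (apply sqrt_lt_R0; lra).
assert (hs2 : sqrt (- x / 2) ^ 2 = - x / 2) by (apply pow2_sqrt; lra).
rewrite (Rabs_pos_eq (sqrt (- x / 2))) in hX by lra.
apply Rabs_le_between in hX.
split; [lra | nra].
Qed.

(** Near a pole f would be unbounded on the axis, against the asymptotic
    condition. *)
Lemma perturbation_analytic_left (f0 f : C -> C) (b : R) :
  hastings_mcleod f0 -> hm_perturbation f0 b f ->
  exists X, forall x : R, x < X -> analytic_at f (RtoC x).
Proof.
intros h0 h.
destruct (hm_perturbation_asymptotic f0 f b h 1 Rlt_0_1) as [X1 hX1].
destruct (proj2 hm_gauge_spec 1 Rlt_0_1) as [X2 hX2].
destruct h as [hsol [hreal _]].
exists (Rmin X1 X2); intros x hx.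
pose proof (Rmin_l X1 X2); pose proof (Rmin_r X1 X2).
destruct (proj1 hsol (RtoC x)) as [han | [m hpole]]; [exact han | exfalso].
pose proof hpole as [_ [a [_ hl]]].
destruct (laurent_isolated f x m a (proj1 hsol) hl) as [r1 [hr1 han]].
destruct (continuity_pt_near (on_axis f0) x 1) as [d [hd0 hd]]; [| lra |].
  apply solves_continuity, (proj1 (hastings_mcleod_separating f0 h0)).
set (r := Rmin (Rmin r1 d) (Rmin X1 X2 - x)).
assert (hr : 0 < r) by (unfold r; repeat apply Rmin_glb_lt; lra).
assert (hr' : r <= r1 /\ r <= d /\ r <= Rmin X1 X2 - x).
  unfold r; pose proof (Rmin_l (Rmin r1 d) (Rmin X1 X2 - x));
  pose proof (Rmin_r (Rmin r1 d) (Rmin X1 X2 - x)); pose proof (Rmin_l r1 d);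
  pose proof (Rmin_r r1 d); lra.
pose proof (Rabs_pos b) as hb; pose proof (Rabs_pos (on_axis f0 x)) as hf0.
apply (pole_unbounded f x m r (Rabs (on_axis f0 x) + Rabs b + 2) hpole hr).
intros y hy.
assert (hyx : y < Rmin X1 X2) by (pose proof (Rle_abs (y - x)); lra).
assert (hany : analytic_at f (RtoC y)) by (apply han; lra).
rewrite (hreal y hany), Rabs_R0; split; [| lra].
specialize (hX1 y ltac:(lra)); specialize (hX2 y ltac:(lra)); specialize (hd y ltac:(lra)).
pose proof (proj1 hm_gauge_spec y) as hg.
change (Re (f (RtoC y))) with (on_axis f y).
assert (hbg : Rabs (b * hm_gauge y) <= Rabs b).
  rewrite Rabs_mult, (Rabs_pos_eq (hm_gauge y)) by lra; nra.
pose proof (Rabs_triang (on_axis f y - on_axis f0 y - b * hm_gauge y) (b * hm_gauge y)) as h1.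
pose proof (Rabs_triang (on_axis f y - on_axis f0 y - b * hm_gauge y + b * hm_gauge y)
  (on_axis f0 y - on_axis f0 x)) as h2.
pose proof (Rabs_triang (on_axis f y - on_axis f0 y - b * hm_gauge y + b * hm_gauge y
  + (on_axis f0 y - on_axis f0 x)) (on_axis f0 x)) as h3.
replace (on_axis f y - on_axis f0 y - b * hm_gauge y + b * hm_gauge y
  + (on_axis f0 y - on_axis f0 x) + on_axis f0 x) with (on_axis f y) in h3 by ring.
lra.
Qed.

(** A residue 1 would make f negative on the left of the pole, but f > f0 > 0 there. *)
Lemma perturbation_first_pole (f0 f : C -> C) (b : R) :
  hastings_mcleod f0 -> 0 < b -> hm_perturbation f0 b f ->
  exists s : R,
    (forall x : R, x < s -> analytic_at f (RtoC x)) /\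
    (exists a, a 0%nat = RtoC (-1) /\ laurent_at f (RtoC s) 1 a) /\
    forall eps, 0 < eps -> exists d, 0 < d /\
      forall x, s - d < x < s -> Rabs (on_axis f x - / (s - x)) < eps.
Proof.
intros h0 hb h.
pose proof (hastings_mcleod_separating f0 h0) as hsep.
pose proof (asymptotic_to_small hm_gauge _ b hm_gauge_spec
  (hm_perturbation_asymptotic f0 f b h) hb 1 Rlt_0_1) as hleft.
destruct (perturbation_analytic_left f0 f b h0 h) as [X hX].
destruct h as [hsol [hreal _]].
destruct (first_singularity f X (proj1 hsol) hX) as [s [hs hbelow]].
  intros hall.
  apply (no_other_global_solution (on_axis f0) (on_axis f) hsep); [| exact hleft].
  intros x; apply on_axis_solves; auto.
exists s; split; [exact hbelow |].
destruct (real_pole f s hsol hreal hs) as [a [e [he2 [ha [hl hpole]]]]].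
assert (hpos : forall x, x < s -> 0 < on_axis f x).
  intros x hx; apply Rlt_trans with (1 := separating_positive _ hsep x).
  apply (comparison (on_axis f0) (on_axis f) (on_axis f0) s); auto.
  - intros t ht; apply on_axis_solves; auto.
  - intros t _; apply hsep.
  - intros t _; apply Rle_refl.
assert (he : e = -1).
  assert (hprod : (e - 1) * (e + 1) = 0) by (replace ((e - 1) * (e + 1)) with (e ^ 2 - 1) by ring; lra).
  apply Rmult_integral in hprod; destruct hprod as [h1 | h1]; [exfalso | lra].
  replace e with 1 in hpole by lra.
  destruct (hpole 1 Rlt_0_1) as [d [hd0 hd]].
  set (t := Rmin d 1 / 2).
  assert (ht : 0 < t < d /\ t < 1).
    assert (0 < Rmin d 1) by (apply Rmin_glb_lt; lra).
    unfold t; pose proof (Rmin_l d 1); pose proof (Rmin_r d 1); lra.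
  specialize (hd (s - t)); specialize (hpos (s - t) ltac:(lra)).
  replace (s - t - s) with (- t) in hd by ring.
  rewrite Rabs_Ropp, (Rabs_pos_eq t) in hd by lra.
  specialize (hd ltac:(lra)); apply Rabs_def2 in hd.
  replace (1 / - t) with (- / t) in hd by (field; lra).
  assert (1 < / t) by (rewrite <- Rinv_1; apply Rinv_lt_contravar; lra).
  lra.
rewrite he in *.
split; [exists a; auto |].
intros eps heps; destruct (hpole eps heps) as [d [hd0 hd]].
exists d; split; [exact hd0 |].
intros x hx; specialize (hd x).
rewrite Rabs_left in hd by lra.
replace (/ (s - x)) with (-1 / (x - s)) by (field; lra).
apply hd; lra.
Qed.

Theorem theorem2p3 :
  forall y : R -> C -> C,
    hastings_mcleod (y 0) ->
    (forall b : R, hm_perturbation (y 0) b (y b)) ->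
    exists sigma : R -> R,
      (forall b : R, 0 < b ->
         (forall x : R, x < sigma b -> analytic_at (y b) (RtoC x)) /\
         simple_pole (y b) (RtoC (sigma b)) /\
         has_residue (y b) (RtoC (sigma b)) (RtoC (-1))) /\
      ((forall b b' : R, 0 < b' -> b' < b -> sigma b < sigma b') /\
       (forall s : R, exists! b : R, 0 < b /\ sigma b = s)) /\
      (forall b b' : R, 0 <= b' -> b' < b ->
         forall x : R, x < sigma b -> on_axis (y b') x < on_axis (y b) x).
Proof.
intros y h0 hy.
destruct (functional_choice (fun b s => 0 < b ->
    (forall x : R, x < s -> analytic_at (y b) (RtoC x)) /\
    (exists a, a 0%nat = RtoC (-1) /\ laurent_at (y b) (RtoC s) 1 a) /\
    forall eps, 0 < eps -> exists d, 0 < d /\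
      forall x, s - d < x < s -> Rabs (on_axis (y b) x - / (s - x)) < eps)) as [sigma hsigma].
  intros b; destruct (Rlt_le_dec 0 b) as [hb | hb]; [| exists 0; intros; lra].
  destruct (perturbation_first_pole (y 0) (y b) b h0 hb (hy b)) as [s hs].
  exists s; intros _; exact hs.
assert (F : pole_family hm_gauge (fun b => on_axis (y b)) sigma).
  constructor.
  - exact hm_gauge_spec.
  - apply hastings_mcleod_separating, h0.
  - intros b x hb hx; apply on_axis_solves; [apply (hy b) | apply (hy b) | apply (hsigma b hb), hx].
  - intros b _; apply hm_perturbation_asymptotic, hy.
  - intros b hb; apply (hsigma b hb).
exists sigma; split; [| split; [split |]].
- intros b hb; destruct (hsigma b hb) as [h1 [[a [ha hl]] _]].
  split; [exact h1 | split].
    split; [apply Nat.lt_0_1 |].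
    exists a; split; [| exact hl].
    rewrite ha; intros e; apply RtoC_inj in e; lra.
  exists 0%nat, a; auto.
- intros b b' hb' hbb'; apply (sigma_decreasing F); assumption.
- intros s; destruct (sigma_surjective F s) as [b [hb hbs]].
  exists b; split; [auto |].
  intros b' [hb' hbs'].
  destruct (Rtotal_order b b') as [hlt | [e | hlt]]; [| exact e |].
    pose proof (sigma_decreasing F b b' hb hlt); lra.
  pose proof (sigma_decreasing F b' b hb' hlt); lra.
- intros b b' hb' hbb' x hx; apply (ordered F b' b); [lra | exact hx].
Qed.
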